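(* Let $\mathbb K$ be a field of characteristic $0$, let $(\Phi,\frac12)$ be a Drinfeld associator over $\mathbb K$, and let $g:\mathbb K\to\overline{GT}(\mathbb K)$ be the unique algebraic morphism of semigroups with $g(\chi)\cdot(\Phi,\frac12)=(\Phi(\chi A,\chi B),\frac{\chi}{2})$ for all $\chi\in\mathbb K$. (i) Let $\mathcal B$ be a symmetric quasi-trivial Cartier category. Then $(\mathcal B_\Phi)_{g(0)}=\mathcal B$ (as symmetric Cartier categories). (ii) Let $\mathcal C$ be a quasi-symmetric category. Then $(\mathcal C_{g(0)})_\Phi=\mathcal C$ (as braided monoidal categories).
   Context: **Filtrations.** A $\mathbb K$-linear monoidal category is filtered if each Hom-space has a filtration $\mathrm{Hom}=F^0\supseteq F^1\supseteq\cdots$ with $F^l\circ F^k\subseteq F^{k+l}$, $F^k\otimes F^l\subseteq F^{k+l}$; separated if $\bigcap_kF^k=0$; complete if $\mathrm{Hom}\to\varprojlim_n\mathrm{Hom}/F^n$ is surjective. Power series in endomorphisms lying in $F^1$ are evaluated by convergence in a complete separated category. **Cartier and quasi-symmetric categories.** A symmetric Cartier category is a preadditive symmetric monoidal category (associativity $a$, symmetry $\sigma$) with a natural transformation $t_{X,Y}:X\otimes Y\to X\otimes Y$ such that $\sigma_{X,Y}t_{X,Y}=t_{Y,X}\sigma_{X,Y}$ and (suppressing $a$) $t_{X,Y\otimes Z}=t_{X,Y}\otimes\mathrm{id}_Z+(\sigma_{X,Y}^{-1}\otimes\mathrm{id})(\mathrm{id}_Y\otimes t_{X,Z})(\sigma_{X,Y}\otimes\mathrm{id})$.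 It is quasi-trivial if it is complete separated filtered monoidal and every $t_{X,Y}\in F^1$. A braided monoidal category is quasi-symmetric if it is complete separated filtered monoidal and $\sigma^2_{X,Y}-\mathrm{id}\in F^1$, where $\sigma^2_{X,Y}:=\sigma_{Y,X}\sigma_{X,Y}$. **Associators.** A Drinfeld associator is $(\Phi,\lambda)$, $\lambda\in\mathbb K$, $\Phi\in\mathbb K\langle\langle A,B\rangle\rangle$ group-like ($A,B$ primitive), $\Phi=1+$ terms of degree $\ge2$, $\Phi(A,B)^{-1}=\Phi(B,A)$, satisfying the pentagon $\Phi(A_{12},A_{23}+A_{24})\Phi(A_{13}+A_{23},A_{34})=\Phi(A_{23},A_{34})\Phi(A_{12}+A_{13},A_{24}+A_{34})\Phi(A_{12},A_{23})$ whenever $A_{ij}=A_{ji}$ satisfy $[A_{ij},A_{kl}]=0$, $[A_{ij}+A_{ik},A_{jk}]=0$ for distinct indices, and the hexagon $e^{\lambda\Lambda}=e^{\lambda A}\Phi(C,A)e^{\lambda C}\Phi(B,C)e^{\lambda B}\Phi(A,B)$ whenever $\Lambda=A+B+C$ commutes with $A,B,C$. For a symmetric quasi-trivial Cartier category $\mathcal B$, $\mathcal B_\Phi$ is the quasi-symmetric braided monoidal category with the same objects, morphisms, tensor product, and $a^\Phi_{X,Y,Z}=a_{X,Y,Z}\circ\Phi(t_{X,Y}\otimes\mathrm{id}_Z,a_{X,Y,Z}^{-1}(\mathrm{id}_X\otimes t_{Y,Z})a_{X,Y,Z})$, $\sigma^\Phi_{X,Y}=\sigma_{X,Y}\circ e^{\lambda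 t_{X,Y}}$ (here $\lambda=\frac12$). **The Grothendieck–Teichmüller semigroup.** $\overline{GT}(\mathbb K)$ consists of pairs $(\lambda,f)$, $\lambda\in\mathbb K$, $f=f(x,y)$ in the pro-unipotent completion of the free group on $x,y$ (identified with group-like series in $\mathbb K\langle\langle A,B\rangle\rangle$ via $x=e^A,y=e^B$), with $f(x,y)=f(y,x)^{-1}$, $f(x_3,x_1)x_3^{m}f(x_2,x_3)x_2^{m}f(x_1,x_2)x_1^{m}=1$ for $x_1x_2x_3=1$, $m=\frac{\lambda-1}2$, and $f(x_{12},x_{23}x_{24})f(x_{13}x_{23},x_{34})=f(x_{23},x_{34})f(x_{12}x_{13},x_{24}x_{34})f(x_{12},x_{23})$ in the pro-unipotent completion of the pure braid group $PB_4$. Multiplication: $(\lambda_1,f_1)(\lambda_2,f_2)=(\lambda_1\lambda_2,f)$, $f(x,y)=f_2(x,y)f_1(x^{\lambda_2},f_2(x,y)^{-1}y^{\lambda_2}f_2(x,y))$. It acts on associators by $(\chi,f)\cdot(\Phi,\lambda)=(f\bullet_\lambda\Phi,\chi\lambda)$, $(f\bullet_\lambda\Phi)(A,B)=\Phi(A,B)f(e^{2\lambda A},\Phi(A,B)^{-1}e^{2\lambda B}\Phi(A,B))$. A morphism $g(\chi)=(\chi,f_\chi)$ is algebraic if each homogeneous component of $f_\chi(e^A,e^B)$ depends polynomially on $\chi$. **The category $\mathcal C_{g(0)}$.** Write $g(0)=(0,f_0)$. For a quasi-symmetric $\mathcal C$, $\mathcal C_{g(0)}$ has the same objects, morphisms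 and tensor product, associativity $a_{X,Y,Z}\circ f_0(\sigma^2_{X,Y}\otimes\mathrm{id}_Z,a_{X,Y,Z}^{-1}(\mathrm{id}_X\otimes\sigma^2_{Y,Z})a_{X,Y,Z})$, symmetry $\sigma_{X,Y}\circ(\sigma_{X,Y}^2)^{-1/2}$, and infinitesimal braiding $t^\sigma_{X,Y}=\frac{d}{d\nu}\big|_{\nu=0}(\sigma^{\nu}_{X,Y})^2$, where $\sigma^\nu_{X,Y}=\sigma_{X,Y}\circ(\sigma_{X,Y}^2)^{(\nu-1)/2}$ and $(\sigma^2)^s=\exp(s\log\sigma^2)$; it is a symmetric quasi-trivial Cartier category. *)

(* Defs.v *)
From HB Require Import structures.
From mathcomp Require Import all_boot all_order all_algebra all_fingroup.
From mathcomp Require Import mathcomp_extra boolp classical_sets functions.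

Set Implicit Arguments.
Unset Strict Implicit.
Unset Printing Implicit Defensive.

Import GRing.Theory.
Local Open Scope ring_scope.
Local Open Scope classical_set_scope.

Section Filtrations.
Variables (K : fieldType) (V : lmodType K) (F : nat -> set V).

Record is_filtration : Prop := IsFiltration {
  filtration_total : forall v, F 0 v;
  filtration_decr : forall n, F n.+1 `<=` F n;
  filtration_zero : forall n, F n 0;
  filtration_lin : forall n (c : K) u v, F n u -> F n v -> F n (c *: u + v) }.

Definition separated : Prop := forall v, (forall n, F n v) -> v = 0.

(* A compatible family of cosets, i.e. a point of lim V/F^n, is given by
   representatives u n of its components. *)
Definition complete : Prop := forall u : nat -> V,
  (forall n, F n (u n.+1 - u n)) -> exists v, forall n, F n (v - u n).

Definition converges (u : nat -> V) (l : V) : Prop :=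
  forall n, exists N, forall m, (N <= m)%N -> F n (u m - l).

(* The limit is unique when F is separated. *)
Definition lim_fil (u : nat -> V) : V := xget 0 [set l | converges u l].

(* [is_deriv0 p d]: p(nu) is a power series in nu with coefficients tending
   to 0, and d is its coefficient of degree one.  In a separated filtration
   over an infinite field, d is determined by p. *)
Definition is_deriv0 (p : K -> V) (d : V) : Prop :=
  exists c : nat -> V, [/\ converges c 0,
    forall nu, converges (fun n => \sum_(k < n) nu ^+ k *: c k) (p nu) &
    d = c 1%N].

Definition deriv0 (p : K -> V) : V := xget 0 [set d | is_deriv0 p d].

End Filtrations.

Record falg (K : fieldType) := FAlg {
  alg_sort :> lmodType K;
  aone : alg_sort;
  amul : alg_sort -> alg_sort -> alg_sort;
  afil : nat -> set alg_sort }.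
Arguments aone {K} R : rename.
Arguments amul {K R} a b : rename.
Arguments afil {K} R n : rename.

Notation "a *a b" := (amul a b) (at level 40, left associativity).

Record is_csfalg (K : fieldType) (R : falg K) : Prop := IsCSFAlg {
  amulA : forall a b c : R, a *a (b *a c) = (a *a b) *a c;
  amul1l : forall a : R, aone R *a a = a;
  amul1r : forall a : R, a *a aone R = a;
  amul_linl : forall (c : K) (a a' b : R),
    (c *: a + a') *a b = c *: (a *a b) + a' *a b;
  amul_linr : forall (c : K) (a b b' : R),
    a *a (c *: b + b') = c *: (a *a b) + a *a b';
  afil_filtration : is_filtration (afil R);
  afil_mul : forall k l (a b : R),
    afil R k a -> afil R l b -> afil R (k + l) (a *a b);
  afil_separated : separated (afil R);
  afil_complete : complete (afil R) }.

(* Noncommutative series, given by their coefficients on words; the letters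
   false and true stand for A and B. *)
Definition series (K : fieldType) := seq bool -> K^o.

Section Evaluation.
Variables (K : fieldType) (R : falg K).

Definition apow (a : R) (k : nat) : R := iter k (amul a) (aone R).

Definition ainv (a : R) : R :=
  xget 0 [set b : R | a *a b = aone R /\ b *a a = aone R].

Definition commutes (a b : R) : Prop := a *a b = b *a a.

Definition wordval (a b : R) (w : seq bool) : R :=
  foldr (fun i r => (if i then b else a) *a r) (aone R) w.

Definition psum (s : series K) (a b : R) (n : nat) : R :=
  \sum_(k < n) \sum_(w : k.-tuple bool) (s w : K) *: wordval a b w.

(* s(a, b), for a and b in F^1 *)
Definition seval (s : series K) (a b : R) : R :=
  lim_fil (afil R) (psum s a b).

Definition aexp (a : R) : R :=
  lim_fil (afil R) (fun n => \sum_(k < n) (k`!)%:R^-1 *: apow a k).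

Definition alog (x : R) : R :=
  lim_fil (afil R) (fun n =>
    \sum_(k < n) ((-1) ^+ k / k.+1%:R) *: apow (x - aone R) k.+1).

Definition unip (x : R) : Prop := afil R 1 (x - aone R).

Definition upow (x : R) (s : K) : R := aexp (s *: alog x).

(* f(x, y) for f an element of the pro-unipotent completion of the free group
   on x, y, written as a series in A, B through x = e^A, y = e^B *)
Definition geval (f : series K) (x y : R) : R := seval f (alog x) (alog y).

End Evaluation.

Section SeriesAlgebra.
Variable K : fieldType.

Definition ser_one : series K := fun w => (w == [::])%:R.

Definition ser_mul (s t : series K) : series K :=
  fun w => \sum_(k < (size w).+1) (s (take k w) : K) * (t (drop k w) : K).

Definition ser_fil (n : nat) : set (series K) :=
  [set s | forall w, (size w < n)%N -> s w = 0].

Definition serA : falg K :=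
  @FAlg K (seq bool -> K^o : lmodType K) ser_one ser_mul ser_fil.

Definition varA : serA := fun w => (w == [:: false])%:R.
Definition varB : serA := fun w => (w == [:: true])%:R.

(* The coefficient of u (x) v in Delta(s), where Delta is the algebra morphism
   for which A and B are primitive: Delta(w) is the sum, over the subsets m of
   the positions of w, of w|_m (x) w|_(complement of m). *)
Definition coproduct (s : series K) (u v : seq bool) : K :=
  \sum_(w : (size u + size v).-tuple bool)
    (s w : K) *+ #|[set m : (size u + size v).-tuple bool |
                 (mask m w == u) && (mask (map negb m) w == v)]%SET|.

Definition group_like (s : series K) : Prop :=
  s [::] = 1 /\ forall u v, coproduct s u v = (s u : K) * (s v : K).

End SeriesAlgebra.
Arguments varA {K}.
Arguments varB {K}.

Definition distinct14 (s : seq nat) : bool :=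
  uniq s && all (fun i => (1 <= i <= 4)%N) s.

Record is_associator (K : fieldType) (P : series K * K) : Prop := IsAssociator {
  assoc_group_like : group_like P.1;
  assoc_deg2 : afil (serA K) 2 ((P.1 : serA K) - aone (serA K));
  assoc_inv : ainv (P.1 : serA K) = seval P.1 varB varA;
  assoc_pentagon : forall (R : falg K) (A : nat -> nat -> R), is_csfalg R ->
    (forall i j, distinct14 [:: i; j] -> afil R 1 (A i j) /\ A i j = A j i) ->
    (forall i j k l, distinct14 [:: i; j; k; l] -> commutes (A i j) (A k l)) ->
    (forall i j k, distinct14 [:: i; j; k] ->
       commutes (A i j + A i k) (A j k)) ->
    let Phi := @seval K R P.1 in
    let A12 := A 1%N 2%N in let A13 := A 1%N 3%N in
    let A23 := A 2%N 3%N in let A24 := A 2%N 4%N in let A34 := A 3%N 4%N in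
    Phi A12 (A23 + A24) *a Phi (A13 + A23) A34 =
    Phi A23 A34 *a Phi (A12 + A13) (A24 + A34) *a Phi A12 A23;
  assoc_hexagon : forall (R : falg K) (A B C : R), is_csfalg R ->
    afil R 1 A -> afil R 1 B -> afil R 1 C ->
    let L := A + B + C in
    commutes L A -> commutes L B -> commutes L C ->
    let Phi := @seval K R P.1 in
    let lam := P.2 in
    aexp (lam *: L) =
      aexp (lam *: A) *a Phi C A *a aexp (lam *: C) *a Phi B C
        *a aexp (lam *: B) *a Phi A B }.

(* Words in the Artin generators sigma_1, sigma_2, sigma_3 of B_4: the letter
   (i, true) is sigma_(i+1), and (i, false) is its inverse. *)
Definition braid_word := seq ('I_3 * bool).

Inductive braid_eq : braid_word -> braid_word -> Prop :=
| braid_refl u : braid_eq u u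
| braid_sym u v : braid_eq u v -> braid_eq v u
| braid_trans u v w : braid_eq u v -> braid_eq v w -> braid_eq u w
| braid_cat u u' v v' :
    braid_eq u u' -> braid_eq v v' -> braid_eq (u ++ v) (u' ++ v')
| braid_cancel i b : braid_eq [:: (i, b); (i, ~~ b)] [::]
| braid_far (i j : 'I_3) : (i.+1 < j)%N ->
    braid_eq [:: (i, true); (j, true)] [:: (j, true); (i, true)]
| braid_near (i j : 'I_3) : j = i.+1 :> nat ->
    braid_eq [:: (i, true); (j, true); (i, true)]
             [:: (j, true); (i, true); (j, true)].

Definition braid_perm (w : braid_word) : 'S_4 :=
  (\prod_(l <- w) tperm (inord l.1) (inord l.1.+1))%g.

Definition pure_braid (w : braid_word) : Prop := braid_perm w = 1%g.

(* x_ij = (s_(j-1) ... s_(i+1)) s_i^2 (s_(j-1) ... s_(i+1))^-1 for i < j *)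
Definition pb_gen (i j : nat) : braid_word :=
  let s k : 'I_3 := inord k.-1 in
  let c := rev (iota i.+1 (j - i.+1)) in
  [seq (s k, true) | k <- c] ++ [:: (s i, true); (s i, true)]
    ++ [seq (s k, false) | k <- rev c].

(* rho is a homomorphism from the pure braid group PB_4 to 1 + F^1 R. *)
Record is_pb_hom (K : fieldType) (R : falg K) (rho : braid_word -> R) : Prop :=
  IsPBHom {
  pb_unip : forall u, pure_braid u -> unip (rho u);
  pb_eq : forall u v, pure_braid u -> pure_braid v -> braid_eq u v ->
    rho u = rho v;
  pb_one : rho [::] = aone R;
  pb_mul : forall u v, pure_braid u -> pure_braid v ->
    rho (u ++ v) = rho u *a rho v }.

(* In [gt_hexagon], R ranges over all targets of the completed group algebra of
   the group <x1, x2, x3 | x1 x2 x3 = 1>; in [gt_pentagon], over those of the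
   completed group algebra lim K[PB_4]/I^n, whose group-like elements form the
   pro-unipotent completion of PB_4.  These completed algebras are themselves
   such R. *)
Record is_GT (K : fieldType) (p : K * series K) : Prop := IsGT {
  gt_group_like : group_like p.2;
  gt_inv : p.2 = ainv (geval p.2 (aexp varB) (aexp varA) : serA K);
  gt_hexagon : forall (R : falg K) (x1 x2 x3 : R), is_csfalg R ->
    unip x1 -> unip x2 -> unip x3 -> x1 *a x2 *a x3 = aone R ->
    let f := @geval K R p.2 in
    let m := (p.1 - 1) / 2 in
    f x3 x1 *a upow x3 m *a f x2 x3 *a upow x2 m *a f x1 x2 *a upow x1 m
      = aone R;
  gt_pentagon : forall (R : falg K) (rho : braid_word -> R), is_csfalg R ->
    is_pb_hom rho ->
    let f := @geval K R p.2 in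
    let x12 := rho (pb_gen 1 2) in let x13 := rho (pb_gen 1 3) in
    let x23 := rho (pb_gen 2 3) in let x24 := rho (pb_gen 2 4) in
    let x34 := rho (pb_gen 3 4) in
    f x12 (x23 *a x24) *a f (x13 *a x23) x34 =
    f x23 x34 *a f (x12 *a x13) (x24 *a x34) *a f x12 x23 }.

Section GT.
Variable K : fieldType.

Definition gt_mul (p1 p2 : K * series K) : K * series K :=
  let x : serA K := aexp varA in
  let y : serA K := aexp varB in
  let f2 : serA K := geval p2.2 x y in
  (p1.1 * p2.1,
   f2 *a geval p1.2 (upow x p2.1) (ainv f2 *a upow y p2.1 *a f2)).

Definition gt_act (p : K * series K) (P : series K * K) : series K * K :=
  let Phi : serA K := P.1 in
  (Phi *a geval p.2 (aexp ((2 * P.2) *: varA))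
            (ainv Phi *a aexp ((2 * P.2) *: varB) *a Phi),
   p.1 * P.2).

(* A homogeneous component is a finite combination of words, so it depends
   polynomially on chi iff each of its coefficients does. *)
Definition algebraic (g : K -> K * series K) : Prop :=
  (forall chi, (g chi).1 = chi) /\
  forall w, exists p : {poly K}, forall chi, (g chi).2 w = p.[chi].

End GT.

(* Data and axioms are kept apart: two categories with the same data are equal,
   and the twisting constructions below only change the data assoc, brd, inf. *)
Record monData (K : fieldType) := MonData {
  Ob : Type;
  Hom : Ob -> Ob -> lmodType K;
  idm : forall X, Hom X X;
  comp : forall X Y Z, Hom Y Z -> Hom X Y -> Hom X Z;
  hfil : forall X Y, nat -> set (Hom X Y);
  tob : Ob -> Ob -> Ob;
  tmor : forall X X' Y Y', Hom X X' -> Hom Y Y' -> Hom (tob X Y) (tob X' Y');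
  tunit : Ob;
  assoc : forall X Y Z, Hom (tob (tob X Y) Z) (tob X (tob Y Z));
  lunit : forall X, Hom (tob tunit X) X;
  runit : forall X, Hom (tob X tunit) X }.
Arguments idm {K C} X : rename.
Arguments comp {K C X Y Z} g f : rename.
Arguments hfil {K C X Y} n : rename.
Arguments tob {K C} X Y : rename.
Arguments tmor {K C X X' Y Y'} f g : rename.
Arguments tunit {K C} : rename.
Arguments assoc {K C} X Y Z : rename.
Arguments lunit {K C} X : rename.
Arguments runit {K C} X : rename.

Notation "g \c f" := (comp g f) (at level 40, left associativity).
Notation "X *t Y" := (tob X Y) (at level 38, left associativity).
Notation "f *h g" := (tmor f g) (at level 38, left associativity).

Definition is_inverse (K : fieldType) (C : monData K) (X Y : Ob C)
    (f : Hom X Y) (g : Hom Y X) : Prop :=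
  g \c f = idm X /\ f \c g = idm Y.

Definition is_iso (K : fieldType) (C : monData K) (X Y : Ob C) (f : Hom X Y) :=
  exists g, is_inverse f g.

Definition hinv (K : fieldType) (C : monData K) (X Y : Ob C) (f : Hom X Y) :
  Hom Y X := xget 0 [set g | is_inverse f g].

Definition endA (K : fieldType) (C : monData K) (X : Ob C) : falg K :=
  @FAlg K (Hom X X) (idm X) (@comp K C X X X) (@hfil K C X X).
Arguments endA {K} C X.

(* Complete separated filtered K-linear monoidal category. *)
Record is_csmon (K : fieldType) (C : monData K) : Prop := IsCSMon {
  compA : forall (X Y Z T : Ob C) (h : Hom Z T) (g : Hom Y Z) (f : Hom X Y),
    h \c (g \c f) = (h \c g) \c f;
  comp1l : forall (X Y : Ob C) (f : Hom X Y), idm Y \c f = f;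
  comp1r : forall (X Y : Ob C) (f : Hom X Y), f \c idm X = f;
  comp_linl : forall (X Y Z : Ob C) (c : K) (g g' : Hom Y Z) (f : Hom X Y),
    (c *: g + g') \c f = c *: (g \c f) + g' \c f;
  comp_linr : forall (X Y Z : Ob C) (c : K) (g : Hom Y Z) (f f' : Hom X Y),
    g \c (c *: f + f') = c *: (g \c f) + g \c f';
  tmor_id : forall X Y : Ob C, idm X *h idm Y = idm (X *t Y);
  tmor_comp : forall (X X' X'' Y Y' Y'' : Ob C)
    (f' : Hom X' X'') (f : Hom X X') (g' : Hom Y' Y'') (g : Hom Y Y'),
    (f' \c f) *h (g' \c g) = (f' *h g') \c (f *h g);
  tmor_linl : forall (X X' Y Y' : Ob C) (c : K) (f f' : Hom X X') (g : Hom Y Y'),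
    (c *: f + f') *h g = c *: (f *h g) + f' *h g;
  tmor_linr : forall (X X' Y Y' : Ob C) (c : K) (f : Hom X X') (g g' : Hom Y Y'),
    f *h (c *: g + g') = c *: (f *h g) + f *h g';
  assoc_iso : forall X Y Z : Ob C, is_iso (assoc X Y Z);
  assoc_nat : forall (X X' Y Y' Z Z' : Ob C)
    (f : Hom X X') (g : Hom Y Y') (h : Hom Z Z'),
    assoc X' Y' Z' \c ((f *h g) *h h) = (f *h (g *h h)) \c assoc X Y Z;
  lunit_iso : forall X : Ob C, is_iso (lunit X);
  lunit_nat : forall (X X' : Ob C) (f : Hom X X'),
    lunit X' \c (idm tunit *h f) = f \c lunit X;
  runit_iso : forall X : Ob C, is_iso (runit X);
  runit_nat : forall (X X' : Ob C) (f : Hom X X'),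
    runit X' \c (f *h idm tunit) = f \c runit X;
  pentagon : forall W X Y Z : Ob C,
    assoc W X (Y *t Z) \c assoc (W *t X) Y Z =
    (idm W *h assoc X Y Z) \c assoc W (X *t Y) Z \c (assoc W X Y *h idm Z);
  triangle : forall X Y : Ob C,
    (idm X *h lunit Y) \c assoc X tunit Y = runit X *h idm Y;
  hfil_filtration : forall X Y : Ob C, is_filtration (@hfil K C X Y);
  hfil_comp : forall (X Y Z : Ob C) k l (g : Hom Y Z) (f : Hom X Y),
    hfil l g -> hfil k f -> hfil (k + l) (g \c f);
  hfil_tmor : forall (X X' Y Y' : Ob C) k l (f : Hom X X') (g : Hom Y Y'),
    hfil k f -> hfil l g -> hfil (k + l) (f *h g);
  hfil_separated : forall X Y : Ob C, separated (@hfil K C X Y);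
  hfil_complete : forall X Y : Ob C, complete (@hfil K C X Y) }.

Record brData (K : fieldType) := BrData {
  br_mon :> monData K;
  brd : forall X Y : Ob br_mon, Hom (X *t Y) (Y *t X) }.
Arguments brd {K C} X Y : rename.

Record carData (K : fieldType) := CarData {
  car_br :> brData K;
  inf : forall X Y : Ob car_br, Hom (X *t Y) (X *t Y) }.
Arguments inf {K B} X Y : rename.

Record is_braiding (K : fieldType) (C : brData K) : Prop := IsBraiding {
  brd_iso : forall X Y : Ob C, is_iso (brd X Y);
  brd_nat : forall (X X' Y Y' : Ob C) (f : Hom X X') (g : Hom Y Y'),
    brd X' Y' \c (f *h g) = (g *h f) \c brd X Y;
  brd_hexagon1 : forall X Y Z : Ob C,
    assoc Y Z X \c brd X (Y *t Z) \c assoc X Y Z =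
    (idm Y *h brd X Z) \c assoc Y X Z \c (brd X Y *h idm Z);
  brd_hexagon2 : forall X Y Z : Ob C,
    hinv (assoc Z X Y) \c brd (X *t Y) Z \c hinv (assoc X Y Z) =
    (brd X Z *h idm Y) \c hinv (assoc X Z Y) \c (idm X *h brd Y Z) }.

Definition brd2 (K : fieldType) (C : brData K) (X Y : Ob C) :
  endA C (X *t Y) := brd Y X \c brd X Y.

Record is_quasisym (K : fieldType) (C : brData K) : Prop := IsQuasiSym {
  qs_csmon : is_csmon C;
  qs_braiding : is_braiding C;
  qs_brd2 : forall X Y : Ob C, unip (brd2 X Y) }.

(* Symmetric quasi-trivial Cartier category. *)
Record is_qtcartier (K : fieldType) (B : carData K) : Prop := IsQTCartier {
  ct_csmon : is_csmon B;
  ct_braiding : is_braiding B;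
  ct_sym : forall X Y : Ob B, brd2 X Y = idm (X *t Y);
  inf_nat : forall (X X' Y Y' : Ob B) (f : Hom X X') (g : Hom Y Y'),
    inf X' Y' \c (f *h g) = (f *h g) \c inf X Y;
  inf_brd : forall X Y : Ob B, brd X Y \c inf X Y = inf Y X \c brd X Y;
  inf_tensor : forall X Y Z : Ob B,
    inf X (Y *t Z) =
    assoc X Y Z \c (inf X Y *h idm Z) \c hinv (assoc X Y Z) +
    assoc X Y Z \c (hinv (brd X Y) *h idm Z) \c hinv (assoc Y X Z)
      \c (idm Y *h inf X Z)
      \c assoc Y X Z \c (brd X Y *h idm Z) \c hinv (assoc X Y Z);
  inf_fil : forall X Y : Ob B, hfil 1 (inf X Y) }.

Definition set_assoc (K : fieldType) (C : monData K)
    (a : forall X Y Z : Ob C, Hom ((X *t Y) *t Z) (X *t (Y *t Z))) : monData K :=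
  @MonData K (Ob C) (@Hom K C) (@idm K C) (@comp K C) (@hfil K C)
    (@tob K C) (@tmor K C) (@tunit K C) a (@lunit K C) (@runit K C).

(* The category B_Phi. *)
Definition tw_assoc (K : fieldType) (P : series K * K) (B : carData K) :
    brData K :=
  @BrData K
    (set_assoc (fun X Y Z : Ob B =>
       assoc X Y Z \c
       (@seval K (endA B ((X *t Y) *t Z)) P.1 (inf X Y *h idm Z)
          (hinv (assoc X Y Z) \c (idm X *h inf Y Z) \c assoc X Y Z))))
    (fun X Y : Ob B =>
       brd X Y \c (@aexp K (endA B (X *t Y)) (P.2 *: inf X Y))).

Section Twist0.
Variables (K : fieldType) (C : brData K).

(* sigma^nu_{X,Y} *)
Definition brd_pow (nu : K) (X Y : Ob C) : Hom (X *t Y) (Y *t X) :=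
  brd X Y \c upow (brd2 X Y) ((nu - 1) / 2).

Definition inf_brd2 (X Y : Ob C) : endA C (X *t Y) :=
  deriv0 (afil (endA C (X *t Y)))
    (fun nu : K => brd_pow nu Y X \c brd_pow nu X Y).

(* The category C_{g(0)}, where g(0) = (0, f0). *)
Definition tw_zero (f0 : series K) : carData K :=
  @CarData K
    (@BrData K
      (set_assoc (fun X Y Z : Ob C =>
         assoc X Y Z \c
         (@geval K (endA C ((X *t Y) *t Z)) f0 (brd2 X Y *h idm Z)
            (hinv (assoc X Y Z) \c (idm X *h brd2 Y Z) \c assoc X Y Z))))
      (fun X Y : Ob C => brd X Y \c upow (brd2 X Y) (- 2^-1)))
    inf_brd2.

End Twist0.

(* Main.v *)
Require Import Defs.
From mathcomp Require Import all_boot all_order all_algebra.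
From mathcomp Require Import boolp classical_sets functions.

Set Implicit Arguments.
Unset Strict Implicit.
Unset Printing Implicit Defensive.

Import GRing.Theory.
(* MathComp shadows [Hom], [compA] and [deriv0]. *)
Import Defs.
Local Open Scope ring_scope.

(* Evaluating [g(0) . (Phi, 1/2) = (Phi(0, 0), 0)] gives, in the series algebra,
   [Phi(A, B) f0(A, Phi^-1 B Phi) = 1], where [f0] is written in logarithmic
   variables.  Substituting [A = t (x) 1] and [B = a^-1 (1 (x) t) a] shows that
   twisting by [Phi] and then by [g(0)] restores the associativity, which is (i).
   For (ii), let [theta] be the endomorphism [A |-> A], [B |-> Phi^-1 B Phi].
   It is injective, being the identity on the associated graded algebra, and it
   maps [f0] to [Phi^-1] and [f0 * Phi(A, f0^-1 B f0)] to [Phi^-1 Phi = 1]; hence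
   [f0(A, B) Phi(A, f0^-1 B f0) = 1].  The symmetries and infinitesimal braidings
   only require that [exp] and [log] are mutually inverse and commute with
   filtered algebra morphisms. *)

(** * Filtered algebras and polynomial evaluation *)

Section FiltrationTheory.
Variables (K : fieldType) (V : lmodType K) (F : nat -> set V).
Hypothesis Ffil : is_filtration F.

Lemma fil0 n : F n 0. Proof. exact: filtration_zero. Qed.

Lemma filZ n (c : K) u : F n u -> F n (c *: u).
Proof. by move=> Fu; rewrite -[c *: u]addr0; apply: filtration_lin (fil0 n). Qed.

Lemma filD n u v : F n u -> F n v -> F n (u + v).
Proof. by move=> Fu Fv; rewrite -[u]scale1r; apply: filtration_lin. Qed.

Lemma filN n u : F n u -> F n (- u).
Proof. by rewrite -scaleN1r; apply: filZ. Qed.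

Lemma filB n u v : F n u -> F n v -> F n (u - v).
Proof. by move=> Fu Fv; apply/filD/filN. Qed.

Lemma fil_sum n (I : Type) (r : seq I) (P : pred I) (E : I -> V) :
  (forall i, P i -> F n (E i)) -> F n (\sum_(i <- r | P i) E i).
Proof. by move=> FE; apply: big_ind => //; [apply: fil0 | apply: filD]. Qed.

Lemma fil_le m n u : (m <= n)%N -> F n u -> F m u.
Proof.
move=> le_mn; rewrite -(subnK le_mn); elim: (n - m)%N => // k IHk Fu.
exact/IHk/(filtration_decr Ffil).
Qed.

Lemma fil_subC n u v : F n (u - v) -> F n (v - u).
Proof. by rewrite -opprB => /filN; rewrite opprK. Qed.

Lemma fil_sub_trans n v u w : F n (u - v) -> F n (v - w) -> F n (u - w).
Proof. by move=> uv vw; rewrite -(subrKA v); apply: filD. Qed.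

Lemma fil_sub0 n u v : F n (u - v) -> F n v -> F n u.
Proof. by move=> uv Fv; rewrite -[u](subrK v); apply: filD. Qed.

Hypothesis Fsep : separated F.

Lemma sep_eq u v : (forall n, F n (u - v)) -> u = v.
Proof. by move=> uv; apply/eqP; rewrite -subr_eq0; apply/eqP/Fsep. Qed.

Lemma converges_unique u l l' : converges F u l -> converges F u l' -> l = l'.
Proof.
move=> ul ul'; apply: sep_eq => n; have [N uN] := ul n; have [N' uN'] := ul' n.
apply: (@fil_sub_trans n (u (maxn N N'))); last exact/uN'/leq_maxr.
exact/fil_subC/uN/leq_maxl.
Qed.

(** The error bound at index [n] is itself a modulus of convergence, and separatedness leaves no
    other limit for [xget] to choose. *)
Lemma lim_fil_eq u l : (forall n, F n (l - u n)) -> lim_fil F u = l.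
Proof.
move=> ul.
have ucvg : converges F u l.
  by move=> n; exists n => m le_nm; apply/fil_subC/(fil_le le_nm)/ul.
by apply: xget_unique => // l' ul'; apply: (converges_unique (u := u)).
Qed.

(** This is the source of all later estimates: exp, log and series evaluations agree with their
    [n]-th partial sums modulo [F n]. *)
Lemma lim_filP u : complete F -> (forall n, F n (u n.+1 - u n)) ->
  forall n, F n (lim_fil F u - u n).
Proof. by move=> Fcomp /Fcomp[l ul] n; rewrite (lim_fil_eq ul). Qed.

End FiltrationTheory.

Section AlgebraTheory.
Variables (K : fieldType) (R : falg K).
Hypothesis hR : is_csfalg R.

Let Rfil : is_filtration (afil R) := afil_filtration hR.
Let Rsep : separated (afil R) := afil_separated hR.
Let Rcomp : complete (afil R) := afil_complete hR.

Lemma amulDl (a b c : R) : (a + b) *a c = a *a c + b *a c.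
Proof. by have := amul_linl hR 1 a b c; rewrite !scale1r. Qed.

Lemma amulDr (a b c : R) : c *a (a + b) = c *a a + c *a b.
Proof. by have := amul_linr hR 1 c a b; rewrite !scale1r. Qed.

Lemma amul0l (a : R) : 0 *a a = 0.
Proof. by apply/(addrI (0 *a a)); rewrite -amulDl !addr0. Qed.

Lemma amul0r (a : R) : a *a 0 = 0.
Proof. by apply/(addrI (a *a 0)); rewrite -amulDr !addr0. Qed.

Lemma amulZl (c : K) (a b : R) : (c *: a) *a b = c *: (a *a b).
Proof. by have := amul_linl hR c a 0 b; rewrite amul0l !addr0. Qed.

Lemma amulZr (c : K) (a b : R) : a *a (c *: b) = c *: (a *a b).
Proof. by have := amul_linr hR c a b 0; rewrite amul0r !addr0. Qed.

Lemma amulNl (a b : R) : (- a) *a b = - (a *a b).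
Proof. by rewrite -!scaleN1r amulZl. Qed.

Lemma amulNr (a b : R) : a *a (- b) = - (a *a b).
Proof. by rewrite -!scaleN1r amulZr. Qed.

Lemma amulBl (a b c : R) : (a - b) *a c = a *a c - b *a c.
Proof. by rewrite amulDl amulNl. Qed.

Lemma amulBr (a b c : R) : c *a (a - b) = c *a a - c *a b.
Proof. by rewrite amulDr amulNr. Qed.

Lemma amul_suml (I : Type) (r : seq I) (P : pred I) (E : I -> R) b :
  (\sum_(i <- r | P i) E i) *a b = \sum_(i <- r | P i) E i *a b.
Proof.
by apply: (big_morph (fun a => a *a b)) => [x y|]; rewrite ?amulDl ?amul0l.
Qed.

Lemma amul_sumr (I : Type) (r : seq I) (P : pred I) (E : I -> R) b :
  b *a (\sum_(i <- r | P i) E i) = \sum_(i <- r | P i) b *a E i.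
Proof. by apply: (big_morph (amul b)) => [x y|]; rewrite ?amulDr ?amul0r. Qed.

Lemma filMr n (a b : R) : afil R n b -> afil R n (a *a b).
Proof. exact: (afil_mul hR (k := 0) (filtration_total Rfil a)). Qed.

Lemma filMl n (a b : R) : afil R n a -> afil R n (a *a b).
Proof.
by move=> Fa; have := afil_mul hR Fa (filtration_total Rfil b); rewrite addn0.
Qed.

Lemma fil_amul n (a a' b b' : R) :
  afil R n (a - a') -> afil R n (b - b') -> afil R n (a *a b - a' *a b').
Proof.
move=> aa' bb'; apply: (fil_sub_trans Rfil (v := a' *a b)).
  by rewrite -amulBl; apply: filMl.
by rewrite -amulBr; apply: filMr.
Qed.

Lemma apow_fil n (a : R) : afil R 1 a -> afil R n (apow a n).
Proof.
move=> Fa; elim: n => [|n IHn]; first exact: filtration_total.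
exact: (afil_mul hR Fa IHn).
Qed.

Lemma apow_sub n k (a b : R) : afil R n (a - b) -> afil R n (apow a k - apow b k).
Proof.
move=> ab; elim: k => [|k IHk]; first by rewrite subrr; apply: fil0.
exact: fil_amul.
Qed.

Lemma ainv_eq (a b : R) : a *a b = aone R -> b *a a = aone R -> ainv a = b.
Proof.
move=> ab ba; apply: xget_unique => // c [ac ca].
by rewrite -[c](amul1l hR) -ba -(amulA hR) ac (amul1r hR).
Qed.

(** The partial sums of exp and log at one element involve only its powers. Evaluation of
    polynomials therefore reduces identities in the noncommutative [R] to identities in the
    commutative ring K[X]. *)
Definition peval (p : {poly K}) (a : R) : R := \sum_(k < size p) p`_k *: apow a k.

Lemma peval_widen n (p : {poly K}) (a : R) : (size p <= n)%N ->
  peval p a = \sum_(k < n) p`_k *: apow a k.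
Proof.
move=> le_pn; rewrite /peval (big_ord_widen n (fun k => p`_k *: apow a k)) //.
rewrite [RHS](bigID (fun k : 'I_n => (k < size p)%N)) /= [X in _ + X]big1 ?addr0 //.
by move=> k; rewrite -leqNgt => le_pk; rewrite nth_default ?scale0r.
Qed.

Lemma pevalD p q a : peval (p + q) a = peval p a + peval q a.
Proof.
pose n := maxn (size p) (size q).
rewrite (@peval_widen n) ?size_polyD // (@peval_widen n p) ?leq_maxl //.
rewrite (@peval_widen n q) ?leq_maxr // -big_split /=.
by apply: eq_bigr => k _; rewrite coefD scalerDl.
Qed.

Lemma pevalC c a : peval c%:P a = c *: aone R.
Proof.
by rewrite (@peval_widen 1) ?size_polyC_leq1 // big_ord1 coefC eqxx.
Qed.

Lemma pevalZ c p a : peval (c *: p) a = c *: peval p a.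
Proof.
rewrite (@peval_widen (size p)) ?size_scale_leq // scaler_sumr.
by apply: eq_bigr => k _; rewrite coefZ scalerA.
Qed.

Lemma pevalMX p a : peval (p * 'X) a = a *a peval p a.
Proof.
rewrite (@peval_widen (size p).+1); last first.
  have [->|p0] := eqVneq p 0; first by rewrite mul0r size_poly0.
  by rewrite size_mulX.
rewrite big_ord_recl coefMX eqxx scale0r add0r amul_sumr.
by apply: eq_bigr => k _; rewrite coefMX /= amulZr.
Qed.

Lemma peval_comm p (a : R) : a *a peval p a = peval p a *a a.
Proof.
rewrite amul_suml amul_sumr; apply: eq_bigr => k _; rewrite amulZl amulZr.
congr (_ *: _); elim: (nat_of_ord k) => [|j IHj].
  by rewrite (amul1l hR) (amul1r hR).
by rewrite -[apow a j.+1]/(a *a apow a j) {1}IHj (amulA hR).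
Qed.

Lemma pevalM p q a : peval (p * q) a = peval p a *a peval q a.
Proof.
elim/poly_ind: p => [|p c IHp].
  by rewrite mul0r -polyC0 pevalC scale0r amul0l.
rewrite mulrDl -mulrA ['X * q]mulrC mulrA !pevalD !pevalMX IHp amulDl pevalC.
by rewrite amulZl (amul1l hR) (amulA hR) mul_polyC pevalZ.
Qed.

Lemma peval_comp p q a : peval (p \Po q) a = peval p (peval q a).
Proof.
elim/poly_ind: p => [|p c IHp]; first by rewrite comp_poly0 -polyC0 !pevalC.
rewrite comp_polyD comp_polyM comp_polyX comp_polyC !pevalD pevalMX pevalM IHp.
by rewrite !pevalC peval_comm.
Qed.

Lemma peval_poly n (c : nat -> K) a :
  peval (\poly_(k < n) c k) a = \sum_(k < n) c k *: apow a k.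
Proof.
rewrite (@peval_widen n) ?size_poly //.
by apply: eq_bigr => k _; rewrite coef_poly ltn_ord.
Qed.

Lemma peval_sub n p a b : afil R n (a - b) -> afil R n (peval p a - peval p b).
Proof.
move=> ab; rewrite -sumrB; apply: (fil_sum Rfil) => k _.
by rewrite -scalerBr; apply/(filZ Rfil)/apow_sub.
Qed.

(** Since [a] lies in F^1, its powers from the [n]-th on vanish modulo F^n, so congruences modulo
    X^n carry over to [R]. *)
Lemma peval_mod n (p q : {poly K}) (a : R) : afil R 1 a ->
  (forall k, (k < n)%N -> p`_k = q`_k) ->
  afil R n (peval p a - peval q a).
Proof.
move=> Fa pq; pose m := maxn (size p) (size q).
rewrite (@peval_widen m) ?leq_maxl // (@peval_widen m q) ?leq_maxr //.
rewrite -sumrB; apply: (fil_sum Rfil) => k _; rewrite -scalerBl.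
have [lt_kn|le_nk] := ltnP k n; first by rewrite pq // subrr scale0r; apply: fil0.
by apply: filZ => //; apply: (fil_le Rfil le_nk); apply: apow_fil.
Qed.

Definition exp_poly n : {poly K} := \poly_(k < n) (k`!%:R)^-1.

(** The truncation of log(1 + X) at degree [n] included, to match the [n] terms of the partial sum
    in [alog]; [exp_poly n] stops one degree earlier. *)
Definition log_poly n : {poly K} :=
  \poly_(k < n.+1) (if k is j.+1 then (-1) ^+ j / j.+1%:R else 0).

Lemma peval_log_poly n a :
  peval (log_poly n) a = \sum_(k < n) ((-1) ^+ k / k.+1%:R) *: apow a k.+1.
Proof. by rewrite peval_poly big_ord_recl scale0r add0r. Qed.

Lemma aexpP n (a : R) : afil R 1 a -> afil R n (aexp a - peval (exp_poly n) a).
Proof.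
move=> Fa; rewrite peval_poly; move: n; apply: lim_filP => // n.
by rewrite big_ord_recr addrC addKr; apply/(filZ Rfil)/apow_fil.
Qed.

Lemma alogP n (x : R) : unip x ->
  afil R n (alog x - peval (log_poly n) (x - aone R)).
Proof.
move=> Fx; rewrite peval_log_poly; move: n; apply: lim_filP => // n.
rewrite big_ord_recr addrC addKr; apply: filZ => //.
by apply: (fil_le Rfil (leqnSn n)); apply: apow_fil.
Qed.

Lemma aexp_eq (a l : R) : (forall n, afil R n (l - peval (exp_poly n) a)) ->
  aexp a = l.
Proof. by move=> al; apply: lim_fil_eq => // n; have := al n; rewrite peval_poly. Qed.

Lemma alog_eq (x l : R) :
  (forall n, afil R n (l - peval (log_poly n) (x - aone R))) -> alog x = l.
Proof. by move=> al; apply: lim_fil_eq => // n; have := al n; rewrite peval_log_poly. Qed.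

Lemma alog_fil (x : R) : unip x -> afil R 1 (alog x).
Proof.
move=> Fx; have := alogP 1 Fx; rewrite peval_log_poly big_ord1.
rewrite expr0 divr1 scale1r [apow _ _](amul1r hR) => /(fil_sub0 Rfil); exact.
Qed.

End AlgebraTheory.

(** * Exponential and logarithm *)

Section ExpLogPolynomials.
Variables (K : fieldType) (charK : [pchar K] =i pred0).

Lemma char0_natS_neq0 n : (n.+1%:R : K) != 0.
Proof. by have /pcharf0P-> := charK. Qed.

Lemma coef_dvdXn n (p : {poly K}) k : 'X^n %| p -> (k < n)%N -> p`_k = 0.
Proof. by move=> /dvdpP[q ->] lt_kn; rewrite coefMXn lt_kn. Qed.

Lemma dvdXn_exp n (p : {poly K}) : p`_0 = 0 -> 'X^n %| p ^+ n.
Proof.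
move=> p0; apply: dvdp_exp2r.
by rewrite -['X]subr0 -polyC0 dvdp_XsubCl rootE horner_coef0 p0.
Qed.

Lemma coef0_exp_poly n : (exp_poly K n.+1)`_0 = 1.
Proof. by rewrite coef_poly fact0 invr1. Qed.

Lemma coef0_log_poly n : (log_poly K n)`_0 = 0.
Proof. by rewrite coef_poly. Qed.

Lemma coef0_comp (p q : {poly K}) : q`_0 = 0 -> (p \Po q)`_0 = p`_0.
Proof. by rewrite -!horner_coef0 horner_comp => ->. Qed.

Lemma deriv_exp_poly n : (exp_poly K n.+1)^`() = exp_poly K n.
Proof.
apply/polyP => k; rewrite coef_deriv !coef_poly ltnS; case: ifP => _; last exact: mul0rn.
by rewrite factS natrM invfM -[LHS]mulr_natl mulVKf ?char0_natS_neq0.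
Qed.

Lemma exp_polyS n : exp_poly K n.+1 = exp_poly K n + (n`!%:R)^-1 *: 'X^n.
Proof.
apply/polyP => k; rewrite coefD coefZ coefXn !coef_poly ltnS leq_eqVlt.
by have [->|_] := eqVneq k n; rewrite ?ltnn ?add0r ?mulr1 // mulr0 addr0.
Qed.

(** The derivative is the geometric sum of the powers of -X, which telescopes against 1 + X. *)
Lemma deriv_log_poly n : (1 + 'X) * (log_poly K n)^`() = 1 - (- 'X) ^+ n.
Proof.
have -> : (log_poly K n)^`() = \sum_(i < n) (- 'X) ^+ i.
  apply/polyP => k; rewrite coef_deriv coef_poly ltnS coef_sum.
  rewrite -(big_mkord xpredT (fun i => ((- 'X) ^+ i)`_k)).
  have coefNX i : ((- 'X : {poly K}) ^+ i)`_k = (-1) ^+ i * (k == i)%:R.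
    have -> : (- 'X : {poly K}) ^+ i = ((-1) ^+ i)%:P * 'X^i.
      by rewrite [LHS]exprNn polyC_exp polyCN polyC1.
    by rewrite coefCM coefXn.
  under eq_bigr do rewrite coefNX.
  case: ltnP => [lt_kn|le_nk]; last first.
    rewrite mul0rn big_nat big1 // => i /andP[_ lt_in].
    by rewrite gtn_eqF ?mulr0 // (leq_trans lt_in).
  rewrite big_mkord (bigD1 (Ordinal lt_kn)) //= eqxx mulr1 big1 => [|i ne_ik].
    by rewrite addr0 -[LHS]mulr_natr divfK ?char0_natS_neq0.
  by rewrite eq_sym (negPf (ne_ik : i != k :> nat)) mulr0.
by rewrite -[RHS]opprB subrX1 -mulNr opprB opprK.
Qed.

(** By the chain rule, and because exp is its own derivative up to one top term, the composite has
    derivative 1 up to terms of high order. Its constant coefficient is 0, so it agrees with X. *)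
Lemma coef_log_exp n k : (k < n)%N ->
  (log_poly K n \Po (exp_poly K n - 1))`_k = 'X`_k.
Proof.
case: n => // n lt_kn; set E := exp_poly K n.+1.
have E0 : (E - 1)`_0 = 0 by rewrite coefB coef0_exp_poly coef1 subrr.
set P := _ \Po _; pose D := (log_poly K n.+1)^`() \Po (E - 1).
have DE : E * D = 1 - (- (E - 1)) ^+ n.+1.
  have := congr1 (comp_poly (E - 1)) (deriv_log_poly n.+1).
  rewrite comp_polyM comp_polyD comp_polyB comp_polyX -!polyC1 !comp_polyC.
  rewrite (rmorphXn (comp_poly (E - 1))) /= (raddfN (comp_poly (E - 1))) /=.
  by rewrite comp_polyX polyC1 subrKC.
have dP : P^`() = 1 - (- (E - 1)) ^+ n.+1 - (n`!%:R^-1 *: D) * 'X^n.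
  rewrite deriv_comp derivB derivC subr0 deriv_exp_poly -DE.
  have -> : exp_poly K n = E - (n`!%:R)^-1 *: 'X^n by rewrite /E exp_polyS addrK.
  by rewrite mulrBr [D * E]mulrC -scalerAr scalerAl.
case: k lt_kn => [|k] lt_kn; first by rewrite coef0_comp // coef0_log_poly coefX.
apply: (mulIf (char0_natS_neq0 k)); rewrite mulr_natr -coef_deriv dP !coefB coefMXn.
rewrite ltnS in lt_kn; rewrite lt_kn subr0 (coef_dvdXn (dvdXn_exp n.+1 _)) ?leqW //.
  by rewrite subr0 coef1 coefX eqSS; case: eqP => [->|]; rewrite ?mul0r ?mulr1.
by rewrite coefN E0 oppr0.
Qed.

(* [G = exp (log (1 + X))] satisfies [(1 + X) G' = G] up to order [n], a
   recursion that determines its coefficients. *)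
Lemma coef_exp_log n k : (k < n)%N ->
  (exp_poly K n \Po log_poly K n)`_k = (1 + 'X)`_k.
Proof.
case: n => // n; set L := log_poly K n.+1; set G := _ \Po _.
have G'E j : (j < n)%N -> G`_j.+1 *+ j.+1 + G`_j *+ j = G`_j.
  move=> lt_jn; transitivity ((1 + 'X) * G^`())`_j.
    rewrite mulrDl mul1r coefD coef_deriv mulrC coefMX.
    by case: j {lt_jn} => [|j]; rewrite ?mulr0n // coef_deriv.
  rewrite deriv_comp mulrCA deriv_log_poly deriv_exp_poly.
  have -> : exp_poly K n = exp_poly K n.+1 - (n`!%:R)^-1 *: 'X^n.
    by rewrite exp_polyS addrK.
  rewrite comp_polyB comp_polyZ comp_Xn_poly -/G mulrBr mulr1 !coefB.
  have dL : 'X^n %| L ^+ n by rewrite dvdXn_exp ?coef0_log_poly.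
  have dX (q : {poly K}) : 'X^(n.+1) %| q * (- 'X) ^+ n.+1.
    by rewrite dvdp_mull // dvdXn_exp // coefN coefX oppr0.
  by rewrite (coef_dvdXn (dX _) (leqW lt_jn)) coefZ (coef_dvdXn dL) // mulr0 !subr0.
elim: k => [_|k IHk lt_kn].
  by rewrite coef0_comp ?coef0_log_poly // coef0_exp_poly coefD coef1 coefX addr0.
have:= G'E k lt_kn; rewrite IHk ?(ltnW lt_kn) //.
move/(canRL (addrK _)) => GE; apply: (mulIf (char0_natS_neq0 k)).
rewrite mulr_natr {}GE !coefD !coef1 !coefX eqSS.
case: k {IHk lt_kn} => [|[|k]] /=.
- by rewrite mulr0n !addr0 subr0 mulr1 add0r.
- by rewrite !add0r mulr1n subrr mul0r.
- by rewrite !addr0 mul0rn subrr mul0r.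
Qed.

(** The binomial theorem divided by k!; truncation does not affect coefficients below [n]. *)
Lemma coef_exp_polyM n (s t : K) k : (k < n)%N ->
  ((\poly_(j < n) (s ^+ j / j`!%:R)) * (\poly_(j < n) (t ^+ j / j`!%:R)))`_k =
  (s + t) ^+ k / k`!%:R.
Proof.
move=> lt_kn; rewrite coefM addrC exprDn mulr_suml; apply: eq_bigr => j _.
have le_jk : (j <= k)%N by rewrite -ltnS.
rewrite !coef_poly (leq_ltn_trans le_jk) // (leq_ltn_trans (leq_subr _ _)) //.
have Ckj : ('C(k, j)%:R : K) != 0 by have /pcharf0P-> := charK; rewrite -lt0n bin_gt0.
rewrite mulrACA [s ^+ j * _]mulrC -invfM -[X in _ = X / _]mulr_natr -natrM.
by rewrite -(bin_fact le_jk) [in RHS]natrM invfM [in RHS]mulrA mulfK.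
Qed.

End ExpLogPolynomials.

Section ExpLog.
Variables (K : fieldType) (charK : [pchar K] =i pred0).
Variables (R : falg K) (hR : is_csfalg R).

Let Rfil : is_filtration (afil R) := afil_filtration hR.
Let Rsep : separated (afil R) := afil_separated hR.

Lemma pevalX (a : R) : peval 'X a = a.
Proof. by rewrite -['X]mul1r -polyC1 pevalMX // pevalC scale1r (amul1r hR). Qed.

Lemma pevalB p q (a : R) : peval (p - q) a = peval p a - peval q a.
Proof. by rewrite -[- q]scaleN1r pevalD pevalZ scaleN1r. Qed.

(** Modulo F^n both functions may be replaced by their truncations, and what remains is the
    congruence [coef_log_exp] between polynomials evaluated at [a]. *)
Lemma alogK (a : R) : afil R 1 a -> alog (aexp a) = a.
Proof.
move=> Fa; apply: alog_eq => // n.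
apply: (fil_sub_trans Rfil (v := peval (log_poly K n) (peval (exp_poly K n - 1) a))).
  rewrite -peval_comp // -{1}[a]pevalX; apply: peval_mod => // k lt_kn.
  by rewrite coef_log_exp.
apply: peval_sub => //; apply: fil_subC => //.
rewrite pevalB -[1]/(1%:P) pevalC scale1r opprB addrA subrK.
exact: aexpP.
Qed.

Lemma aexpK (x : R) : unip x -> aexp (alog x) = x.
Proof.
move=> Fx; apply: aexp_eq => // n.
apply: (fil_sub_trans Rfil
  (v := peval (exp_poly K n) (peval (log_poly K n) (x - aone R)))).
  have {1}-> : x = peval (1 + 'X) (x - aone R).
    by rewrite pevalD -[1]/(1%:P) pevalC pevalX scale1r subrKC.
  rewrite -peval_comp //; apply: peval_mod => // k lt_kn.
  by rewrite coef_exp_log.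
by apply: peval_sub => //; apply: fil_subC => //; apply: alogP.
Qed.

Lemma apowZ c (a : R) k : apow (c *: a) k = c ^+ k *: apow a k.
Proof.
elim: k => [|k IHk]; first by rewrite scale1r.
by rewrite exprS -scalerA -[LHS]/((c *: a) *a apow _ k) IHk amulZl ?amulZr.
Qed.

Lemma peval_expZ n c (a : R) :
  peval (exp_poly K n) (c *: a) = peval (\poly_(k < n) (c ^+ k / k`!%:R)) a.
Proof.
rewrite !peval_poly; apply: eq_bigr => k _.
by rewrite apowZ scalerA mulrC.
Qed.

(** Both exponents are multiples of one element, so the product can be computed among polynomials in
    [a]. *)
Lemma aexpD s t (a : R) : afil R 1 a ->
  aexp (s *: a) *a aexp (t *: a) = aexp ((s + t) *: a).
Proof.
move=> Fa; apply/esym/aexp_eq => // n.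
have FZ c : afil R 1 (c *: a) by apply: filZ.
apply: (fil_sub_trans Rfil (v :=
    peval (exp_poly K n) (s *: a) *a peval (exp_poly K n) (t *: a))).
  by apply: fil_amul => //; apply: aexpP.
rewrite !peval_expZ -pevalM //; apply: peval_mod => // k lt_kn.
by rewrite coef_exp_polyM // coef_poly lt_kn.
Qed.

Lemma aexp0 : aexp (0 : R) = aone R.
Proof.
apply: aexp_eq => // n; case: n => [|n]; first exact: filtration_total.
rewrite peval_poly big_ord_recl fact0 invr1 scale1r big1 ?addr0 ?subrr => [|k _].
  exact: fil0.
by rewrite [apow 0 _](amul0l hR) scaler0.
Qed.

Lemma upowD s t (x : R) : unip x -> upow x s *a upow x t = upow x (s + t).
Proof. by move=> Fx; apply: aexpD => //; apply: alog_fil. Qed.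

Lemma upow0 (x : R) : upow x 0 = aone R.
Proof. by rewrite /upow scale0r aexp0. Qed.

Lemma upow1 (x : R) : unip x -> upow x 1 = x.
Proof. by move=> Fx; rewrite /upow scale1r aexpK. Qed.

Lemma upow_aexp s (a : R) : afil R 1 a -> upow (aexp a) s = aexp (s *: a).
Proof. by move=> Fa; rewrite /upow alogK. Qed.

(** The power x^(-1) = exp(-log x) is a two-sided inverse, so the choice made in [ainv] returns a
    genuine inverse on 1 + F^1. *)
Lemma ainv_unip (x : R) : unip x -> ainv x *a x = aone R /\ x *a ainv x = aone R.
Proof.
move=> Fx; have xV : x *a upow x (-1) = aone R.
  by rewrite -{1}[x]upow1 // upowD // subrr upow0.
have Vx : upow x (-1) *a x = aone R.
  by rewrite -{2}[x]upow1 // upowD // addNr upow0.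
by rewrite (ainv_eq hR xV Vx).
Qed.

End ExpLog.

(** * Derivatives and noncommutative series *)

Section Derivative.
Variables (K : fieldType) (charK : [pchar K] =i pred0).

Section Uniqueness.
Variables (V : lmodType K) (F : nat -> set V).
Hypotheses (Ffil : is_filtration F) (Fsep : separated F).

(* [P(2 nu) - 2^N P(nu)] has lower degree than [P], and its coefficients are
   nonzero multiples of those of [P]. *)
Lemma fil_coef m N (d : nat -> V) :
  (forall nu : K, F m (\sum_(k < N) nu ^+ k *: d k)) ->
  forall k, (k < N)%N -> F m (d k).
Proof.
elim: N d => // N IHN d FP; pose e k : V := (2 ^+ k - 2 ^+ N : K) *: d k.
have Fd k : (k < N)%N -> F m (d k).
  move=> lt_kN; have e0 : (2 ^+ k - 2 ^+ N : K) != 0.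
    rewrite -!natrX -opprB oppr_eq0 -natrB ?leq_exp2l ?(ltnW lt_kN) //.
    by have /pcharf0P-> := charK; rewrite subn_eq0 leq_exp2l // -ltnNge.
  rewrite -[d k](scalerK e0); apply: (filZ Ffil); apply: (IHN e) => // nu.
  have := filB Ffil (FP (2 * nu)) (filZ Ffil (2 ^+ N) (FP nu)).
  rewrite scaler_sumr -sumrB big_ord_recr /= exprMn scalerA subrr addr0.
  congr F; apply: eq_bigr => j _.
  by rewrite /e exprMn !scalerA -scalerBl mulrBr ![_ * nu ^+ _]mulrC.
move=> k; rewrite ltnS leq_eqVlt => /predU1P[->|/Fd//].
have := FP 1; rewrite big_ord_recr /= expr1n scale1r => FN.
rewrite -[d N](addKr (\sum_(j < N) 1 ^+ j *: d j)) addrC; apply: filB => //.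
by apply: (fil_sum Ffil) => j _; apply/(filZ Ffil)/Fd.
Qed.

(** The difference of two expansions of [p] has all its values zero. Modulo [F m] it has finitely
    many terms, so [fil_coef] puts its coefficients in [F m], for every [m]. *)
Lemma deriv0_eq (p : K -> V) d : is_deriv0 F p d -> deriv0 F p = d.
Proof.
move=> pd; apply: xget_unique => // d' [c' [c'0 pc' ->]].
have [c [c0 pc ->]] := pd; apply: (sep_eq Fsep) => m.
have [N cN] := c0 m; have [N' cN'] := c'0 m.
(* From index [M] on, both coefficient sequences lie in [F m]; the 2 ensures that the index 1 of the
   derivative is below [M]. *)
pose M := maxn 2 (maxn N N'); pose e k := c' k - c k.
apply: (fil_coef (N := M) (d := e)); last by rewrite leq_max.
move=> nu; have [n0 pn0] := pc nu m; have [n1 pn1] := pc' nu m.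
(* The length [n] depends on [nu], whereas [fil_coef] needs a uniform one; the terms between [M] and
   [n] lie in [F m] and are discarded. *)
pose n := maxn M (maxn n0 n1).
have Fn : F m (\sum_(k < n) nu ^+ k *: e k).
  under eq_bigr do rewrite scalerBr.
  rewrite sumrB; apply: (fil_sub_trans Ffil (v := p nu)).
    by apply: pn1; rewrite !leq_max leqnn !orbT.
  by apply: (fil_subC Ffil); apply: pn0; rewrite !leq_max leqnn !orbT.
rewrite (big_ord_widen n (fun k => nu ^+ k *: e k)) ?leq_maxl //.
have := Fn; rewrite (bigID (fun k : 'I_n => (k < M)%N)) /= => /(filB Ffil) FB.
have /FB : F m (\sum_(k < n | ~~ (k < M)%N) nu ^+ k *: e k); last by rewrite addrK.
apply: (fil_sum Ffil) => k; rewrite -leqNgt => le_Mk; apply: (filZ Ffil).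
have Fc0 u : F m (u - 0) -> F m u by rewrite subr0.
apply: (filB Ffil); apply: Fc0.
  by apply: cN'; apply: leq_trans le_Mk; rewrite !leq_max leqnn !orbT.
by apply: cN; apply: leq_trans le_Mk; rewrite !leq_max leqnn !orbT.
Qed.

End Uniqueness.

Lemma deriv0_aexp (R : falg K) (a : R) : is_csfalg R -> afil R 1 a ->
  deriv0 (afil R) (fun nu : K => aexp (nu *: a)) = a.
Proof.
move=> hR Fa; have Rfil := afil_filtration hR.
apply: (deriv0_eq Rfil (afil_separated hR)).
exists (fun k => (k`!%:R)^-1 *: apow a k); split.
- move=> n; exists n => m le_nm; rewrite subr0.
  by apply: (fil_le Rfil le_nm); apply/(filZ Rfil)/apow_fil.
- move=> nu n; exists n => m le_nm; apply: (fil_subC Rfil).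
  apply: (fil_le Rfil le_nm).
  have := aexpP hR m (filZ Rfil nu Fa); rewrite peval_expZ // peval_poly.
  by congr (afil _ _ (_ - _)); apply: eq_bigr => k _; rewrite scalerA.
- by rewrite -[(1`!)%N]/1%N invr1 scale1r [apow a 1](amul1r hR).
Qed.

End Derivative.

(** Such maps preserve limits, hence commute with exp, log, powers and evaluation of series.
    Evaluations, conjugations and tensoring with an identity are the instances needed. *)
Record is_hom (K : fieldType) (R S : falg K) (h : R -> S) : Prop := IsHom {
  hom_linear : forall (c : K) u v, h (c *: u + v) = c *: h u + h v;
  hom_one : h (aone R) = aone S;
  hom_mul : forall a b, h (a *a b) = h a *a h b;
  hom_fil : forall n a, afil R n a -> afil S n (h a) }.

Section Linear.
Variables (K : fieldType) (V W : lmodType K) (h : V -> W).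
Hypothesis hlin : forall (c : K) u v, h (c *: u + v) = c *: h u + h v.

Lemma linmapD u v : h (u + v) = h u + h v.
Proof. by rewrite -{1}[u]scale1r hlin scale1r. Qed.

Lemma linmap0 : h 0 = 0.
Proof. by apply: (addrI (h 0)); rewrite -linmapD !addr0. Qed.

Lemma linmapZ (c : K) u : h (c *: u) = c *: h u.
Proof. by rewrite -[c *: u]addr0 hlin linmap0 addr0. Qed.

Lemma linmapB u v : h (u - v) = h u - h v.
Proof. by rewrite linmapD -[- v]scaleN1r linmapZ scaleN1r. Qed.

Lemma linmap_sum (I : Type) (r : seq I) (P : pred I) (E : I -> V) :
  h (\sum_(i <- r | P i) E i) = \sum_(i <- r | P i) h (E i).
Proof. exact: (big_morph h linmapD linmap0). Qed.

End Linear.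

Section Words.
Variables (K : fieldType) (R : falg K).
Hypothesis hR : is_csfalg R.

Let Rfil : is_filtration (afil R) := afil_filtration hR.

Lemma wordval_fil (a b : R) w : afil R 1 a -> afil R 1 b ->
  afil R (size w) (wordval a b w).
Proof.
move=> Fa Fb; elim: w => [|i w IHw]; first exact: filtration_total.
by apply: (afil_mul hR (k := 1) _ IHw); case: i.
Qed.

Lemma wordval_cat (a b : R) u v :
  wordval a b (u ++ v) = wordval a b u *a wordval a b v.
Proof.
elim: u => [|i u IHu] /=; first by rewrite (amul1l hR).
by rewrite IHu (amulA hR).
Qed.

(** Letters are exchanged one at a time: each exchange contributes a factor in F^2 where a letter
    only gives F^1, which gains one degree over the length of the word. *)
Lemma wordval_sub (a b b' : R) w : afil R 1 a -> afil R 1 b ->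
  afil R 2 (b' - b) -> afil R (size w).+1 (wordval a b' w - wordval a b w).
Proof.
move=> Fa Fb bb'; elim: w => [|i w IHw] /=; first by rewrite subrr; apply: fil0.
have Fb' : afil R 1 b'.
  by apply: (fil_sub0 Rfil _ Fb); apply: (fil_le Rfil _ bb').
apply: (fil_sub_trans Rfil (v := (if i then b' else a) *a wordval a b w)).
  by rewrite -amulBr //; apply: (afil_mul hR (k := 1) _ IHw); case: i.
rewrite -amulBl //; apply: (afil_mul hR (k := 2) _ (wordval_fil w Fa Fb)).
by case: i => //; rewrite subrr; apply: fil0.
Qed.

Lemma psum_step (s : series K) (a b : R) n : afil R 1 a -> afil R 1 b ->
  afil R n (psum s a b n.+1 - psum s a b n).
Proof.
move=> Fa Fb; rewrite /psum big_ord_recr /= addrAC subrr add0r.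
apply: (fil_sum Rfil) => w _; apply: (filZ Rfil).
by rewrite -{1}(size_tuple w); apply: wordval_fil.
Qed.

Lemma sevalP (s : series K) (a b : R) n : afil R 1 a -> afil R 1 b ->
  afil R n (seval s a b - psum s a b n).
Proof.
move=> Fa Fb; move: n; apply: (lim_filP Rfil (afil_separated hR) (afil_complete hR)).
by move=> n; apply: psum_step.
Qed.

Lemma seval_eq (s : series K) (a b l : R) :
  (forall n, afil R n (l - psum s a b n)) -> seval s a b = l.
Proof. exact: (lim_fil_eq Rfil (afil_separated hR)). Qed.

Lemma psum_linear (a b : R) n (c : K) (s t : serA K) :
  psum (c *: s + t) a b n = c *: psum s a b n + psum t a b n.
Proof.
rewrite /psum scaler_sumr -big_split; apply: eq_bigr => k _ /=.
rewrite scaler_sumr -big_split; apply: eq_bigr => w _ /=.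
by rewrite scalerA -scalerDl.
Qed.

Lemma seval_linear (a b : R) (c : K) (s t : serA K) :
  afil R 1 a -> afil R 1 b ->
  seval (c *: s + t) a b = c *: seval s a b + seval t a b.
Proof.
move=> Fa Fb; apply: seval_eq => n; rewrite psum_linear opprD addrACA -scalerBr.
by apply: (filD Rfil); [apply: (filZ Rfil)|]; apply: sevalP.
Qed.

Lemma psum0 n (a b : R) (s : series K) : ser_fil n s -> psum s a b n = 0.
Proof.
move=> s0; apply: big1 => k _; apply: big1 => w _.
by rewrite s0 ?scale0r // size_tuple.
Qed.

Lemma seval_fil n (a b : R) (s : series K) : afil R 1 a -> afil R 1 b ->
  ser_fil n s -> afil R n (seval s a b).
Proof.
by move=> Fa Fb s0; have := sevalP s n Fa Fb; rewrite (psum0 _ _ s0) subr0.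
Qed.

(** The double sum meets every word of length below [n] exactly once, so the indicator of [w]
    selects at most one term. *)
Lemma sum_words n (V : lmodType K) (G : seq bool -> V) w :
  \sum_(k < n) \sum_(u : k.-tuple bool) ((u : seq bool) == w)%:R *: G u =
  if (size w < n)%N then G w else 0.
Proof.
have zero k : (size w != k) ->
    \sum_(u : k.-tuple bool) ((u : seq bool) == w)%:R *: G u = 0.
  move=> ne_wk; apply: big1 => u _; case: eqP => [uw|]; last by rewrite scale0r.
  by rewrite -uw size_tuple eqxx in ne_wk.
case: ifP => [lt_wn|/negbT]; last first.
  rewrite -leqNgt => le_nw; apply: big1 => k _; apply: zero.
  by rewrite gtn_eqF // (leq_trans (ltn_ord k)).
rewrite (bigD1 (Ordinal lt_wn)) //= (bigD1 (in_tuple w)) //= eqxx scale1r.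
rewrite !big1 ?addr0 // => [k ne_kw|u ne_uw].
  by apply: zero; rewrite eq_sym.
by rewrite (negPf (ne_uw : (u : seq bool) != w)) scale0r.
Qed.

Lemma seval0 (s : series K) : seval s (0 : R) 0 = s [::] *: aone R.
Proof.
apply: seval_eq => n; case: n => [|n]; first exact: filtration_total.
have := sum_words n.+1 (fun u => s u *: aone R) [::]; rewrite /= => <-.
rewrite -sumrB; apply: (fil_sum Rfil) => k _; rewrite -sumrB.
apply: (fil_sum Rfil) => -[[|i w] ?] _ /=; first by rewrite scale1r subrr; apply: fil0.
by rewrite if_same (amul0l hR) scaler0 scale0r subrr; apply: fil0.
Qed.

End Words.

(** * The completed free algebra and its universal property *)

Section SeriesTheory.
Variable K : fieldType.
Implicit Types s t : series K.

Lemma serZDE (c : K) (s t : serA K) w :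
  (c *: s + t : serA K) w = c * (s w : K) + (t w : K) :> K.
Proof. by []. Qed.

Lemma serZE (c : K) (s : serA K) w : (c *: s : serA K) w = c * (s w : K) :> K.
Proof. by []. Qed.

Lemma serBE (s t : serA K) w : (s - t : serA K) w = (s w : K) - (t w : K) :> K.
Proof. by []. Qed.

Lemma ser_mulE s t w : ser_mul s t w =
  \sum_(k < (size w).+1) (s (take k w) : K) * (t (drop k w) : K) :> K.
Proof. by []. Qed.

(** The cut at position 0 is split off, and the other cuts form a product with the left derivative
    of [s] along [x]. Unit laws and associativity follow from this recursion by induction on
    words. *)
Lemma ser_mul_cons s t x w :
  ser_mul s t (x :: w) = (s [::] : K) * t (x :: w) + ser_mul (fun v => s (x :: v)) t w.
Proof. by rewrite /ser_mul big_ord_recl take0 drop0. Qed.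

Lemma ser_mul_nil s t : ser_mul s t [::] = (s [::] : K) * t [::].
Proof. by rewrite /ser_mul big_ord1. Qed.

Lemma ser_mul_linl (c : K) (s s' t : serA K) :
  ser_mul (c *: s + s') t = (c *: (ser_mul s t : serA K) + ser_mul s' t : serA K).
Proof.
apply/funext => w; rewrite serZDE !ser_mulE mulr_sumr -big_split; apply: eq_bigr => k _.
by rewrite serZDE /= mulrA -mulrDl.
Qed.

Lemma ser_mul_linr (c : K) (s t t' : serA K) :
  ser_mul s (c *: t + t') = (c *: (ser_mul s t : serA K) + ser_mul s t' : serA K).
Proof.
apply/funext => w; rewrite serZDE !ser_mulE mulr_sumr -big_split; apply: eq_bigr => k _.
by rewrite serZDE /= mulrCA -mulrDr.
Qed.

Lemma ser_mul1 s : ser_mul s (ser_one K) = s.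
Proof.
apply/funext => w; elim: w s => [|x w IHw] s.
  by rewrite ser_mul_nil mulr1.
by rewrite ser_mul_cons mulr0 add0r IHw.
Qed.

Lemma ser_mul0l (t : series K) : ser_mul (fun=> 0) t = fun=> 0.
Proof. by apply/funext => w; apply: big1 => k _; rewrite mul0r. Qed.

Lemma ser_1mul s : ser_mul (ser_one K) s = s.
Proof.
apply/funext => -[|x w]; first by rewrite ser_mul_nil mul1r.
by rewrite ser_mul_cons mul1r [ser_mul _ _]ser_mul0l addr0.
Qed.

Lemma ser_mulA s t r : ser_mul s (ser_mul t r) = ser_mul (ser_mul s t) r.
Proof.
apply/funext => w; elim: w s t r => [|x w IHw] s t r.
  by rewrite !ser_mul_nil mulrA.
rewrite [LHS]ser_mul_cons [RHS]ser_mul_cons IHw !ser_mul_nil ser_mul_cons.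
(* The left derivative of a product: the constant term of [s] times the derivative of [t], plus the
   derivative of [s] times [t]. *)
have -> : (fun v => ser_mul s t (x :: v)) =
    ((s [::] : K) *: ((fun v => t (x :: v)) : serA K) +
     ser_mul (fun v => s (x :: v)) t : serA K).
  by apply/funext => v; rewrite ser_mul_cons.
rewrite ser_mul_linl mulrDr -!addrA mulrA; congr (_ + _).
Qed.

Lemma ser_filM k l s t :
  ser_fil k s -> ser_fil l t -> ser_fil (k + l) (ser_mul s t).
Proof.
move=> s0 t0 w lt_w; apply: big1 => i _.
have le_iw : (i <= size w)%N by rewrite -ltnS.
have [lt_ik|le_ki] := ltnP i k.
  by rewrite s0 ?mul0r // size_take_min (leq_ltn_trans (geq_minl _ _)).
by rewrite t0 ?mulr0 // size_drop -(ltn_add2l i) subnKC // (leq_trans lt_w) ?leq_add2r.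
Qed.

Lemma serA_csfalg : is_csfalg (serA K).
Proof.
split; first exact: ser_mulA.
- exact: ser_1mul.
- exact: ser_mul1.
- exact: ser_mul_linl.
- exact: ser_mul_linr.
- split=> [s w|n s s0 w lt_wn|n w _|n c s t s0 t0 w lt_wn] //.
    by rewrite s0 // (leq_trans lt_wn).
  by rewrite serZDE s0 // t0 // mulr0 addr0.
- by move=> k l s t; apply: ser_filM.
- by move=> s s0; apply/funext => w; apply: (s0 (size w).+1).
(* The coefficient at [w] is the same in all [u n] with [n] greater than the length of [w], so it is
   read off at the first such index. *)
- move=> u uS; exists (fun w => u (size w).+1 w) => n w lt_wn.
  rewrite serBE -(subnK lt_wn); elim: (n - _)%N => [|m IHm]; first by rewrite subrr.
  rewrite addSn; have := uS (m + (size w).+1)%N w; rewrite serBE => uE.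
  by apply: etrans IHm; congr (_ - _); apply/eqP; rewrite -subr_eq0 uE // leq_addl.
Qed.

Lemma wordval_var w : wordval (varA : serA K) varB w = fun v => (w == v)%:R.
Proof.
elim: w => [|i w IHw] /=; first by apply/funext => v; rewrite eq_sym.
have -> : (if i then varB else varA) = (fun v => (v == [:: i])%:R) :> series K.
  by case: i.
rewrite {}IHw; apply/funext => -[|x v]; first by rewrite [LHS]ser_mul_nil mul0r.
rewrite [LHS]ser_mul_cons mul0r add0r eqseq_cons.
have -> : (fun u => (x :: u == [:: i])%:R) =
    ((i == x)%:R *: (ser_one K : serA K) : serA K).
  by apply/funext => u; rewrite serZE -natrM mulnb eqseq_cons eq_sym.
rewrite -[ser_mul _ _]/(@amul K (serA K) _ _) (amulZl serA_csfalg).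
by rewrite (amul1l serA_csfalg) serZE -natrM mulnb.
Qed.

Lemma psum_var_fil n s : afil (serA K) n ((s : serA K) - psum s varA varB n).
Proof.
move=> w lt_wn; rewrite serBE.
suff -> : (psum s varA varB n : serA K) w = s w by rewrite subrr.
have := sum_words n (fun u => s u) w; rewrite lt_wn => <-.
rewrite /psum fct_sumE; apply: eq_bigr => k _; rewrite fct_sumE.
apply: eq_bigr => u _; rewrite wordval_var.
exact: mulrC.
Qed.

Lemma varA_fil : afil (serA K) 1 varA.
Proof. by case. Qed.

Lemma varB_fil : afil (serA K) 1 varB.
Proof. by case. Qed.

Lemma seval_var s : seval s (varA : serA K) varB = s.
Proof. by apply: (seval_eq serA_csfalg) => n; apply: psum_var_fil. Qed.

Variables (R : falg K) (hR : is_csfalg R) (a b : R).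
Hypotheses (Fa : afil R 1 a) (Fb : afil R 1 b).
Let Rfil : is_filtration (afil R) := afil_filtration hR.
Let ev (s : serA K) : R := seval s a b.
Let ev_lin (c : K) s t : ev (c *: (s : serA K) + t) = c *: ev s + ev t.
Proof. exact: seval_linear. Qed.

Lemma seval_wordval w : seval (wordval (varA : serA K) varB w) a b = wordval a b w.
Proof.
apply: (seval_eq hR) => n; rewrite wordval_var /psum.
under eq_bigr do under eq_bigr do rewrite eq_sym.
rewrite (sum_words n (wordval a b) w); case: ltnP => [_|le_nw].
  by rewrite subrr; apply: fil0.
by rewrite subr0; apply: (fil_le Rfil le_nw); apply: wordval_fil.
Qed.

(** Only multiplicativity needs work. Modulo F^n both factors may be replaced by noncommutative
    polynomials, bilinearity reduces these to monomials, and on monomials the product is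
    concatenation. *)
Lemma seval_hom : is_hom (fun s : serA K => seval s a b).
Proof.
have evW w : ev (wordval (varA : serA K) varB w) = wordval a b w by apply: seval_wordval.
split=> [||s t|n s] //.
- by have := seval_wordval [::].
- rewrite -!/(ev _); apply: (sep_eq (afil_separated hR)) => n.
  have sn := psum_var_fil (n := n) s; have tn := psum_var_fil (n := n) t.
  have ev_fil u v : afil (serA K) n (u - v) -> afil R n (ev u - ev v).
    by move=> uv; rewrite -(linmapB ev_lin); apply: seval_fil.
  apply: (fil_sub_trans Rfil (v := ev (psum s varA varB n *a psum t varA varB n))).
    by apply: ev_fil; apply: (fil_amul serA_csfalg).
  suff -> : ev (psum s varA varB n *a psum t varA varB n) =
      ev (psum s varA varB n) *a ev (psum t varA varB n).
    by apply: (fil_amul hR); apply/(fil_subC Rfil)/ev_fil.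
  (* The right factor is expanded first, with [u] arbitrary; the condition on [u] is then checked by
     expanding the left factor. *)
  have evM u v :
      (forall w, ev (u *a wordval (varA : serA K) varB w) = ev u *a wordval a b w) ->
      ev (u *a psum v varA varB n) = ev u *a ev (psum v varA varB n).
    move=> evu; rewrite /psum (amul_sumr serA_csfalg) !(linmap_sum ev_lin) (amul_sumr hR).
    apply: eq_bigr => k _.
    rewrite (amul_sumr serA_csfalg) !(linmap_sum ev_lin) (amul_sumr hR).
    apply: eq_bigr => w _; rewrite (amulZr serA_csfalg) !(linmapZ ev_lin) (amulZr hR).
    by rewrite evu evW.
  apply: evM => v.
  rewrite /psum (amul_suml serA_csfalg) !(linmap_sum ev_lin) (amul_suml hR).
  apply: eq_bigr => k _.
  rewrite (amul_suml serA_csfalg) !(linmap_sum ev_lin) (amul_suml hR).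
  apply: eq_bigr => w _; rewrite (amulZl serA_csfalg) !(linmapZ ev_lin) (amulZl hR).
  by rewrite -(wordval_cat serA_csfalg) !evW (wordval_cat hR).
- by apply: seval_fil.
Qed.

Lemma seval_varA : seval (varA : series K) a b = a.
Proof.
have := seval_wordval [:: false]; rewrite [RHS](amul1r hR) => {2}<-.
by congr (seval _ a b); rewrite [RHS](amul1r serA_csfalg).
Qed.

Lemma seval_varB : seval (varB : series K) a b = b.
Proof.
have := seval_wordval [:: true]; rewrite [RHS](amul1r hR) => {2}<-.
by congr (seval _ a b); rewrite [RHS](amul1r serA_csfalg).
Qed.

End SeriesTheory.

(** * Morphisms and twist identities *)

Section HomTheory.
Variables (K : fieldType) (charK : [pchar K] =i pred0).
Variables (R S : falg K) (hR : is_csfalg R) (hS : is_csfalg S).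
Variables (h : R -> S) (hh : is_hom h).

Let hlin := hom_linear hh.

Lemma hom_apow (a : R) k : h (apow a k) = apow (h a) k.
Proof.
elim: k => [|k IHk]; first exact: hom_one.
by rewrite [apow a _]/(a *a apow a k) (hom_mul hh) IHk.
Qed.

Lemma hom_peval p (a : R) : h (peval p a) = peval p (h a).
Proof.
rewrite /peval (linmap_sum hlin); apply: eq_bigr => k _.
by rewrite (linmapZ hlin) hom_apow.
Qed.

Lemma hom_wordval (a b : R) w : h (wordval a b w) = wordval (h a) (h b) w.
Proof.
elim: w => [|i w IHw] /=; first exact: hom_one.
by rewrite (hom_mul hh) IHw; case: i.
Qed.

Lemma hom_unip (x : R) : unip x -> unip (h x).
Proof. by rewrite /unip -(hom_one hh) -(linmapB hlin); apply: hom_fil. Qed.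

Lemma hom_aexp (a : R) : afil R 1 a -> h (aexp a) = aexp (h a).
Proof.
move=> Fa; apply/esym/(aexp_eq hS) => n.
by rewrite -hom_peval -(linmapB hlin); apply: (hom_fil hh); apply: aexpP.
Qed.

Lemma hom_alog (x : R) : unip x -> h (alog x) = alog (h x).
Proof.
move=> Fx; apply/esym/(alog_eq hS) => n.
rewrite -(hom_one hh) -(linmapB hlin) -hom_peval -(linmapB hlin).
by apply: (hom_fil hh); apply: alogP.
Qed.

Lemma hom_upow (x : R) s : unip x -> h (upow x s) = upow (h x) s.
Proof.
move=> Fx; rewrite /upow hom_aexp ?(linmapZ hlin) ?hom_alog //.
by apply: (filZ (afil_filtration hR)); apply: alog_fil.
Qed.

Lemma hom_seval s (a b : R) : afil R 1 a -> afil R 1 b ->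
  h (seval s a b) = seval s (h a) (h b).
Proof.
move=> Fa Fb; apply/esym/(seval_eq hS) => n.
have -> : psum s (h a) (h b) n = h (psum s a b n).
  rewrite /psum (linmap_sum hlin); apply: eq_bigr => k _.
  rewrite (linmap_sum hlin); apply: eq_bigr => w _.
  by rewrite (linmapZ hlin) hom_wordval.
by rewrite -(linmapB hlin); apply: (hom_fil hh); apply: sevalP.
Qed.

Lemma hom_ainv (x : R) : unip x -> h (ainv x) = ainv (h x).
Proof.
move=> /(ainv_unip charK hR)[Vx xV]; apply/esym/(ainv_eq hS).
  by rewrite -(hom_mul hh) xV hom_one.
by rewrite -(hom_mul hh) Vx hom_one.
Qed.

End HomTheory.

Section Conjugation.
Variables (K : fieldType) (charK : [pchar K] =i pred0).
Variables (R : falg K) (hR : is_csfalg R).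

(** The orientation is that of the second argument of [f] in [gt_act]. *)
Definition aconj (p a : R) : R := ainv p *a a *a p.

Lemma aconj_fil n p a : afil R n a -> afil R n (aconj p a).
Proof. by move=> Fa; apply: filMl => //; apply: filMr. Qed.

Lemma aconj_hom p : unip p -> is_hom (aconj p).
Proof.
move=> Fp; have [Vp pV] := ainv_unip charK hR Fp; split=> [c u v||a b|n a].
- by rewrite /aconj (amul_linr hR) (amul_linl hR).
- by rewrite /aconj (amul1r hR).
- rewrite /aconj !(amulA hR); congr (_ *a _ *a _).
  by rewrite -!(amulA hR) pV (amul1r hR).
- exact: aconj_fil.
Qed.

Lemma aconj_ainv p a : unip p -> aconj (ainv p) (aconj p a) = a.
Proof.
move=> Fp; have [Vp pV] := ainv_unip charK hR Fp.
rewrite /aconj (ainv_eq hR Vp pV) !(amulA hR) pV (amul1l hR).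
by rewrite -(amulA hR) pV (amul1r hR).
Qed.

End Conjugation.

Section TwistIdentities.
Variables (K : fieldType) (charK : [pchar K] =i pred0).
Variables (Phi f : series K).

Let A : serA K := varA.
Let B : serA K := varB.
Let hA : is_csfalg (serA K) := serA_csfalg K.
Let Afil := afil_filtration hA.

Lemma unip_series (s : serA K) : s [::] = 1 -> unip s.
Proof. by move=> s1 [] //= _; rewrite serBE s1 subrr. Qed.

Hypotheses (Phi_unip : unip (Phi : serA K)) (f_unip : unip (f : serA K)).
Hypothesis Phi_f : (Phi : serA K) *a seval f A (aconj (Phi : serA K) B) = aone _.

Let Q := aconj (Phi : serA K) B.
Let theta (s : serA K) : serA K := seval s A Q.

Let FA : afil (serA K) 1 A. Proof. exact: varA_fil. Qed.
Let FB : afil (serA K) 1 B. Proof. exact: varB_fil. Qed.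
Let FQ : afil (serA K) 1 Q. Proof. exact: aconj_fil. Qed.

Let theta_hom : is_hom theta. Proof. exact: seval_hom. Qed.

(** The difference is Phi^-1 [B, Phi - 1], and both entries of the commutator lie in F^1. *)
Let Q_sub : afil (serA K) 2 (Q - B).
Proof.
have [VP PV] := ainv_unip charK hA Phi_unip.
have -> : Q - B = ainv (Phi : serA K) *a
    (B *a ((Phi : serA K) - aone _) - ((Phi : serA K) - aone _) *a B).
  rewrite (amulBr hA _ _ B) (amulBl hA _ _ B) (amul1l hA) (amul1r hA) opprB addrA subrK.
  by rewrite (amulBr hA) !(amulA hA) VP (amul1l hA).
apply: filMr => //; apply: (filB Afil); first exact: (afil_mul hA (k := 1) (l := 1)).
exact: (afil_mul hA (k := 1) (l := 1)).
Qed.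

(* [theta] is the identity on the associated graded algebra. *)
Let theta_inj s : theta s = 0 -> s = 0.
Proof.
move=> ts0; apply: (afil_separated hA); elim=> [|n IHn].
  exact: (filtration_total Afil).
suff : afil (serA K) n.+1 (theta s - s).
  by rewrite ts0 sub0r => /(filN Afil); rewrite opprK.
rewrite -{2}[s]seval_var; apply: (fil_sub_trans Afil (v := psum s A Q n.+1)).
  exact: sevalP.
apply: (fil_sub_trans Afil (v := psum s A B n.+1)); last first.
  by apply: (fil_subC Afil); apply: sevalP.
rewrite -sumrB; apply: (fil_sum Afil) => k _; rewrite -sumrB.
apply: (fil_sum Afil) => w _; rewrite -scalerBr.
have [lt_kn|le_nk] := ltnP k n.
  by rewrite IHn ?size_tuple // scale0r; apply: (fil0 Afil).
apply: (filZ Afil); apply: (fil_le Afil (n := (size w).+1)).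
  by rewrite size_tuple.
exact: wordval_sub.
Qed.

(** The hypothesis [Phi_f] is the universal case; evaluation at [a], [b] is a morphism and carries
    it to [R]. *)
Lemma twist_associator (R : falg K) (a b : R) : is_csfalg R ->
  afil R 1 a -> afil R 1 b ->
  seval Phi a b *a seval f a (aconj (seval Phi a b) b) = aone R.
Proof.
move=> hR Fa Fb; have eh := seval_hom hR Fa Fb.
have := congr1 (fun s : serA K => seval s a b) Phi_f.
rewrite (hom_mul eh) (hom_one eh) (hom_seval hA hR eh) //.
rewrite !(hom_mul eh) (hom_ainv charK hA hR eh) //.
by rewrite seval_varA // seval_varB.
Qed.

(** Evaluation at [a], [b] again reduces the claim to the free algebra, where it may be tested after
    applying the injective morphism [theta]. *)
Lemma twist_inverse (R : falg K) (a b : R) : is_csfalg R ->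
  afil R 1 a -> afil R 1 b ->
  seval f a b *a seval Phi a (aconj (seval f a b) b) = aone R.
Proof.
move=> hR Fa Fb; have eh := seval_hom hR Fa Fb.
(* By [Phi_f], [theta f] is a right inverse of the invertible series Phi. *)
have tf : theta f = ainv (Phi : serA K).
  have [VP _] := ainv_unip charK hA Phi_unip.
  by rewrite -[theta f](amul1l hA) -VP -(amulA hA) Phi_f (amul1r hA).
have tA : theta A = A by apply: seval_varA.
have tB : theta B = Q by apply: seval_varB.
have FfB : afil (serA K) 1 (aconj (f : serA K) B) by apply: aconj_fil.
suff E : (f : serA K) *a seval Phi A (aconj (f : serA K) B) = aone _.
  have := congr1 (fun s : serA K => seval s a b) E.
  rewrite (hom_mul eh) (hom_one eh) (hom_seval hA hR eh) //.
  rewrite !(hom_mul eh) (hom_ainv charK hA hR eh) //.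
  by rewrite seval_varA // seval_varB.
apply: (@subr0_eq (serA K)); apply: theta_inj.
rewrite (linmapB (hom_linear theta_hom)) (hom_one theta_hom) (hom_mul theta_hom).
rewrite (hom_seval hA hA theta_hom) // tA /aconj !(hom_mul theta_hom).
(* The morphism [theta] sends f^-1 B f to Phi (Phi^-1 B Phi) Phi^-1 = B, so the product becomes
   Phi^-1 Phi. *)
rewrite (hom_ainv charK hA hA theta_hom) // tf tB -/(aconj _ Q) aconj_ainv //.
by rewrite seval_var (ainv_unip charK hA Phi_unip).1 subrr.
Qed.

End TwistIdentities.

(** * Endomorphism algebras of a filtered monoidal category *)

Section Categories.
Variables (K : fieldType) (C : monData K) (hC : is_csmon C).

Lemma endA_csfalg (X : Ob C) : is_csfalg (endA C X).
Proof.
split.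
- by move=> a b c; apply: compA.
- by move=> a; apply: comp1l.
- by move=> a; apply: comp1r.
- by move=> c a a' b; apply: comp_linl.
- by move=> c a b b'; apply: comp_linr.
- exact: hfil_filtration.
- by move=> k l a b Fa Fb; rewrite addnC; apply: hfil_comp.
- exact: hfil_separated.
- exact: hfil_complete.
Qed.

Lemma hinv_eq (X Y : Ob C) (f : Hom X Y) g : is_inverse f g -> hinv f = g.
Proof.
move=> [gf fg]; apply: xget_unique => // g' [g'f fg'].
by rewrite -[g'](comp1l hC) -gf -(compA hC) fg' (comp1r hC).
Qed.

Lemma hinvP (X Y : Ob C) (f : Hom X Y) : is_iso f -> is_inverse f (hinv f).
Proof. by move=> [g fg]; rewrite (hinv_eq fg). Qed.

Lemma tmor_homl (X Z : Ob C) :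
  is_hom (fun f : endA C X => f *h idm Z : endA C (X *t Z)).
Proof.
split=> [c u v||a b|n a Fa].
- exact: tmor_linl.
- exact: tmor_id.
- by rewrite -[X in _ *h X](comp1l hC); apply: tmor_comp.
- rewrite -[n]addn0; apply: (hfil_tmor hC) => //.
  exact: (filtration_total (hfil_filtration hC _ _)).
Qed.

Lemma tmor_homr (X Z : Ob C) :
  is_hom (fun f : endA C X => idm Z *h f : endA C (Z *t X)).
Proof.
split=> [c u v||a b|n a Fa].
- exact: tmor_linr.
- exact: tmor_id.
- by rewrite -[X in X *h _](comp1l hC); apply: tmor_comp.
- rewrite -[n]add0n; apply: (hfil_tmor hC) => //.
  exact: (filtration_total (hfil_filtration hC _ _)).
Qed.

Lemma hconj_hom (X Y : Ob C) (f : Hom X Y) : is_iso f ->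
  is_hom (fun u : endA C Y => hinv f \c u \c f : endA C X).
Proof.
move=> /hinvP[Vf fV]; split=> [c u v||a b|n a Fa].
- by rewrite (comp_linr hC) (comp_linl hC).
- by rewrite (comp1r hC).
- change (hinv f \c (a \c b) \c f = (hinv f \c a \c f) \c (hinv f \c b \c f)).
  by rewrite !(compA hC) -(compA hC _ f) fV (comp1r hC).
- have Ft X1 X2 (g : @Hom K C X1 X2) : hfil 0 g.
    exact: (filtration_total (hfil_filtration hC _ _)).
  rewrite -[n]add0n; apply: (hfil_comp hC) => //.
  by rewrite -[n]addn0; apply: (hfil_comp hC).
Qed.

Lemma hconj_eq (X Y : Ob C) (f : Hom X Y) (u : Hom Y Y) (v : Hom X X) :
  is_iso f -> f \c v = u \c f -> hinv f \c u \c f = v.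
Proof.
by move=> /hinvP[Vf _] fv; rewrite -(compA hC) -fv (compA hC) Vf (comp1l hC).
Qed.

Lemma hconjK (X Y : Ob C) (f : Hom X Y) (u : Hom Y Y) :
  is_iso f -> f \c (hinv f \c u \c f) = u \c f.
Proof. by move=> /hinvP[_ fV]; rewrite !(compA hC) fV (comp1l hC). Qed.

Variable charK : [pchar K] =i pred0.

(** The inverse of f p is p^-1 f^-1. With [f] an associativity and [p] its twist, this is how the
    conjugated argument of the action on associators arises in a category. *)
Lemma hconj_twist (X Y : Ob C) (f : Hom X Y) (p : endA C X) (u : Hom Y Y) :
  is_iso f -> unip p ->
  hinv (f \c p) \c u \c (f \c p) = aconj p (hinv f \c u \c f : endA C X).
Proof.
move=> /hinvP[Vf fV] /(ainv_unip charK (endA_csfalg X))[Vp pV].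
rewrite (@hinv_eq _ _ _ (ainv p \c hinv f)).
  by rewrite /aconj /amul /= !(compA hC).
split.
  by rewrite (compA hC) -(compA hC _ (hinv f)) Vf (comp1r hC).
by rewrite (compA hC) -(compA hC f) [p \c _]pV (comp1r hC).
Qed.

End Categories.

(** A twist leaves objects, morphisms and tensor product unchanged by computation, so equality of
    categories reduces to pointwise equalities that need no transport. *)
Lemma brData_ext (K : fieldType) (C : brData K) a
    (b : forall X Y : Ob C, Hom (X *t Y) (Y *t X)) :
  (forall X Y Z, a X Y Z = assoc X Y Z) -> (forall X Y, b X Y = brd X Y) ->
  @BrData K (set_assoc a) b = C.
Proof.
move=> aE bE.
have {aE} -> : a = @assoc K C by do 3!apply/functional_extensionality_dep => ?.
have {bE} -> : b = @brd K C by do 2!apply/functional_extensionality_dep => ?.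
by case: C {a b} => -[].
Qed.

Lemma carData_ext (K : fieldType) (C : carData K) a
    (b : forall X Y : Ob C, Hom (X *t Y) (Y *t X))
    (t : forall X Y : Ob C, Hom (X *t Y) (X *t Y)) :
  (forall X Y Z, a X Y Z = assoc X Y Z) -> (forall X Y, b X Y = brd X Y) ->
  (forall X Y, t X Y = inf X Y) ->
  @CarData K (@BrData K (set_assoc a) b) t = C.
Proof.
move=> aE bE tE.
have {aE} -> : a = @assoc K C by do 3!apply/functional_extensionality_dep => ?.
have {bE} -> : b = @brd K C by do 2!apply/functional_extensionality_dep => ?.
have {tE} -> : t = @inf K C by do 2!apply/functional_extensionality_dep => ?.
by case: C {a b t} => -[[]].
Qed.

(** * The twisted categories *)

Lemma addr_half (K : fieldType) (c : K) : [pchar K] =i pred0 -> c / 2 + c / 2 = c.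
Proof.
by move=> charK; rewrite -mulrDr -div1r -mulrDl divff ?mulr1 ?(char0_natS_neq0 charK 1).
Qed.

(** * Twisting by the associator, then by g(0) *)

Section UntwistAssociator.
Variables (K : fieldType) (charK : [pchar K] =i pred0) (Phi f : series K).
Hypotheses (Phi_unip : unip (Phi : serA K)).
Hypothesis Phi_f :
  (Phi : serA K) *a seval f varA (aconj (Phi : serA K) varB) = aone _.
Variables (B : carData K) (hB : is_qtcartier B).

Let hC : is_csmon B := ct_csmon hB.
Let hE X : is_csfalg (endA B X) := endA_csfalg hC X.
Let E c X Y : endA B (X *t Y) := aexp (c *: (inf X Y : endA B (X *t Y))).
Let Einf X Y : afil (endA B (X *t Y)) 1 (inf X Y). Proof. exact: inf_fil. Qed.

(** Conjugation by the symmetry is an algebra morphism taking [inf Y X] to [inf X Y], and it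
    commutes with exp. *)
Lemma brd_aexp_inf c X Y : brd X Y \c E c X Y = E c Y X \c brd X Y.
Proof.
have iso := brd_iso (ct_braiding hB) X Y; have hh := hconj_hom hC iso.
rewrite -hconjK //; congr (_ \c _); apply/esym.
have FZ : afil (endA B (Y *t X)) 1 (c *: (inf Y X : endA B (Y *t X))).
  exact: (filZ (afil_filtration (hE _))).
rewrite [LHS](hom_aexp (hE _) (hE _) hh FZ) (linmapZ (hom_linear hh)).
by rewrite (hconj_eq hC iso (inf_brd hB X Y)).
Qed.

Lemma brd_aexp_inf2 c X Y : (brd Y X \c E c Y X) \c (brd X Y \c E c X Y) = E (c + c) X Y.
Proof.
rewrite -[LHS](compA hC) (compA hC (E c Y X)) -brd_aexp_inf !(compA hC).
rewrite -[brd Y X \c brd X Y]/(brd2 X Y) (ct_sym hB) (comp1l hC).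
exact: (aexpD charK (hE _) c c (Einf X Y)).
Qed.

Let C : brData K := tw_assoc (Phi, 2^-1) B.

(** The two braidings contribute 1/2 each to the exponent; the value lambda = 1/2 thus makes log of
    the double braiding exactly t. *)
Lemma brd2_tw_assoc (X Y : Ob B) : brd2 (C := C) X Y = aexp (inf X Y : endA B (X *t Y)).
Proof.
by rewrite [LHS](brd_aexp_inf2 2^-1 X Y) -div1r addr_half // /E scale1r.
Qed.

(** The value s = -1/2 recovers the symmetry of [B], and s = (nu - 1)/2 gives sigma^nu. *)
Lemma brd_upow_tw_assoc s (X Y : Ob B) :
  brd (C := C) X Y \c upow (brd2 (C := C) X Y) s = brd X Y \c E (2^-1 + s) X Y.
Proof.
rewrite brd2_tw_assoc [upow _ _](upow_aexp charK (hE _) s (Einf X Y)).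
rewrite /E -(aexpD charK (hE _) 2^-1 s (Einf X Y)).
exact (esym (compA hC (brd X Y) (E 2^-1 X Y) (E s X Y))).
Qed.

Lemma tw_zero_tw_assoc : tw_zero C f = B.
Proof.
apply: carData_ext => [X Y Z|X Y|X Y].
- set a := inf X Y *h idm Z : endA B (X *t Y *t Z).
  set b := hinv (assoc X Y Z) \c (idm X *h inf Y Z) \c assoc X Y Z : endA B (X *t Y *t Z).
  have iso : is_iso (assoc X Y Z) := assoc_iso hC X Y Z.
  have hl := tmor_homl hC (X *t Y) Z; have hr := tmor_homr hC (Y *t Z) X.
  have hc := hconj_hom hC iso.
  have Fa : afil (endA B (X *t Y *t Z)) 1 a := hom_fil hl (Einf X Y).
  have Fb : afil (endA B (X *t Y *t Z)) 1 b := hom_fil hc (hom_fil hr (Einf Y Z)).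
  pose p := seval Phi a b.
  have Fp : unip p := hom_unip (seval_hom (hE _) Fa Fb) Phi_unip.
  have brdl : brd2 (C := C) X Y *h idm Z = aexp a.
    by rewrite brd2_tw_assoc; apply: (hom_aexp (hE _) (hE _) hl).
  (* The associativity here is the twisted one, [assoc] composed with [p], which is why the exponent
     [b] appears conjugated by [p]. *)
  have brdr : hinv (assoc (C := C) X Y Z) \c (idm X *h brd2 (C := C) Y Z)
      \c assoc (C := C) X Y Z
      = aexp (aconj p b).
    rewrite brd2_tw_assoc [LHS](hconj_twist hC charK _ iso Fp).
    rewrite -(hom_aexp (hE _) (hE _) (aconj_hom charK (hE _) Fp) Fb).
    congr (aconj p _); rewrite -[RHS](hom_aexp (hE _) (hE _) hc) //.
      by rewrite -(hom_aexp (hE _) (hE _) hr).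
    exact: (hom_fil hr).
  have Fc : afil (endA B (X *t Y *t Z)) 1 (aconj p b) by apply: aconj_fil.
  rewrite /geval brdl brdr !(alogK charK (hE _)) //.
  rewrite -[LHS](compA hC).
  rewrite [X in _ \c X](twist_associator charK Phi_unip Phi_f (hE _) Fa Fb).
  exact: comp1r.
- rewrite [LHS]brd_upow_tw_assoc subrr /E scale0r (aexp0 (hE _)).
  exact: comp1r.
- rewrite /= /inf_brd2.
  (* Each factor carries the exponent 1/2 + (nu - 1)/2 = nu/2, so the square is e^(nu t), whose
     derivative at 0 is t. *)
  have -> : (fun nu => brd_pow (C := C) nu Y X \c brd_pow (C := C) nu X Y) =
      fun nu => E nu X Y.
    apply/functional_extensionality_dep => nu.
    rewrite /brd_pow !brd_upow_tw_assoc [LHS]brd_aexp_inf2; congr (E _ X Y).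
    by rewrite addrACA addr_half // -div1r addr_half // subrKC.
  exact: (deriv0_aexp charK (hE _) (Einf X Y)).
Qed.

End UntwistAssociator.

(** * Twisting by g(0), then by the associator *)

Section TwistAssociator.
Variables (K : fieldType) (charK : [pchar K] =i pred0) (Phi f : series K).
Hypotheses (Phi_unip : unip (Phi : serA K)) (f_unip : unip (f : serA K)).
Hypothesis Phi_f :
  (Phi : serA K) *a seval f varA (aconj (Phi : serA K) varB) = aone _.
Variables (C : brData K) (hC : is_quasisym C).

Let hM : is_csmon C := qs_csmon hC.
Let hE X : is_csfalg (endA C X) := endA_csfalg hM X.
Let Ubrd X Y : unip (brd2 X Y) := qs_brd2 hC X Y.

(** Conjugation by the braiding exchanges the two double braidings, by associativity of composition
    alone, and it commutes with powers. *)
Lemma brd_upow_brd2 s (X Y : Ob C) :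
  brd X Y \c upow (brd2 X Y) s = upow (brd2 Y X) s \c brd X Y.
Proof.
have iso := brd_iso (qs_braiding hC) X Y; have hh := hconj_hom hM iso.
rewrite -hconjK //; congr (_ \c _); apply/esym.
rewrite [LHS](hom_upow (hE _) (hE _) hh s (Ubrd Y X)).
by rewrite (hconj_eq hM iso (compA hM _ _ _)).
Qed.

(** Once the powers are moved past the braiding, the exponents add up to 1 + 2 (nu - 1)/2 = nu. *)
Lemma brd_pow2 nu (X Y : Ob C) :
  brd_pow nu Y X \c brd_pow nu X Y = upow (brd2 X Y) nu.
Proof.
rewrite /brd_pow -[LHS](compA hM) (compA hM (upow (brd2 Y X) _)) -brd_upow_brd2.
rewrite !(compA hM) -[brd Y X \c brd X Y]/(brd2 X Y).
rewrite -[LHS]/(brd2 X Y *a upow (brd2 X Y) _ *a upow (brd2 X Y) _).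
rewrite -{1}[brd2 X Y](upow1 charK (hE _)) // !(upowD charK (hE _)) //.
by rewrite -addrA addr_half // subrKC.
Qed.

Lemma inf_brd2E (X Y : Ob C) : inf_brd2 X Y = alog (brd2 X Y).
Proof.
rewrite /inf_brd2.
have -> : (fun nu => brd_pow nu Y X \c brd_pow nu X Y) =
    fun nu => aexp (nu *: alog (brd2 X Y)).
  by apply/functional_extensionality_dep => nu; rewrite brd_pow2.
exact: (deriv0_aexp charK (hE _) (alog_fil (hE _) (Ubrd X Y))).
Qed.

Lemma tw_assoc_tw_zero : tw_assoc (Phi, 2^-1) (tw_zero C f) = C.
Proof.
(* The twisted category has the Hom-spaces of [C], so its associativity and braiding can be passed
   to [brData_ext] as data over [C]. *)
pose D : brData K := tw_assoc (Phi, 2^-1) (tw_zero C f).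
apply: (@brData_ext K C (@assoc K D) (@brd K D)) => [X Y Z|X Y].
- pose tl : endA C (X *t Y) := alog (brd2 X Y).
  pose tr : endA C (Y *t Z) := alog (brd2 Y Z).
  have Ftl : afil (endA C (X *t Y)) 1 tl := alog_fil (hE _) (Ubrd X Y).
  have Ftr : afil (endA C (Y *t Z)) 1 tr := alog_fil (hE _) (Ubrd Y Z).
  have iso : is_iso (assoc X Y Z) := assoc_iso hM X Y Z.
  have hl := tmor_homl hM (X *t Y) Z; have hr := tmor_homr hM (Y *t Z) X.
  have hc := hconj_hom hM iso.
  pose a : endA C (X *t Y *t Z) := tl *h idm Z.
  pose b : endA C (X *t Y *t Z) := hinv (assoc X Y Z) \c (idm X *h tr) \c assoc X Y Z.
  have Fa : afil (endA C (X *t Y *t Z)) 1 a := hom_fil hl Ftl.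
  have Fb : afil (endA C (X *t Y *t Z)) 1 b := hom_fil hc (hom_fil hr Ftr).
  have aE : alog (brd2 X Y *h idm Z : endA C (X *t Y *t Z)) = a.
    exact: esym (hom_alog (hE _) (hE _) hl (Ubrd X Y)).
  have bE : alog (hinv (assoc X Y Z) \c (idm X *h brd2 Y Z) \c assoc X Y Z
      : endA C (X *t Y *t Z)) = b.
    rewrite -[LHS](hom_alog (hE _) (hE _) hc (hom_unip hr (Ubrd Y Z))).
    by rewrite -(hom_alog (hE _) (hE _) hr).
  pose q := seval f a b.
  have Fq : unip q := hom_unip (seval_hom (hE _) Fa Fb) f_unip.
  (* The associativity of the intermediate category, read in [C]: it is [assoc] followed on the
     right by the twist [q]. *)
  pose a0 : @Hom K C _ _ := assoc (C := tw_zero C f) X Y Z.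
  have a0E : a0 = assoc X Y Z \c q by rewrite /a0 /= /geval aE bE.
  rewrite -[LHS]/(a0 \c @seval K (endA C (X *t Y *t Z)) Phi (inf_brd2 X Y *h idm Z)
    (hinv a0 \c (idm X *h inf_brd2 Y Z) \c a0)).
  rewrite a0E (hconj_twist hM charK _ iso Fq) !inf_brd2E -[LHS](compA hM).
  rewrite [X in _ \c X](twist_inverse charK Phi_unip f_unip Phi_f (hE _) Fa Fb).
  exact: comp1r.
- rewrite -[LHS]/(brd X Y \c upow (brd2 X Y) (- 2^-1) \c
    aexp (2^-1 *: (inf_brd2 X Y : endA C (X *t Y)))).
  (* Since t is the logarithm of the double braiding, e^(t/2) is its square root and cancels the
     power -1/2. *)
  have u0 : upow (brd2 X Y) (- 2^-1) *a upow (brd2 X Y) 2^-1 = aone _.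
    by rewrite (upowD charK (hE _)) // addNr upow0.
  by rewrite inf_brd2E -/(upow _ _) -[LHS](compA hM) [X in _ \c X]u0 (comp1r hM).
Qed.

End TwistAssociator.

Theorem theorem2p14 (K : fieldType) (charK : [pchar K] =i pred0)
    (Phi : series K) (hPhi : is_associator (Phi, 2^-1))
    (g : K -> K * series K)
    (g_GT : forall chi, is_GT (g chi))
    (g_mul : forall chi1 chi2, g (chi1 * chi2) = gt_mul (g chi1) (g chi2))
    (g_alg : algebraic g)
    (g_act : forall chi, gt_act (g chi) (Phi, 2^-1) =
       (@seval K (serA K) Phi (chi *: varA) (chi *: varB), chi / 2)) :
  (forall B : carData K, is_qtcartier B ->
     tw_zero (tw_assoc (Phi, 2^-1) B) (g 0).2 = B) /\
  (forall C : brData K, is_quasisym C ->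
     tw_assoc (Phi, 2^-1) (tw_zero C (g 0).2) = C).
Proof.
have hA := serA_csfalg K.
have Phi1 : Phi [::] = 1 := (assoc_group_like hPhi).1.
have Phi_unip := unip_series Phi1.
have f_unip : unip ((g 0).2 : serA K) := unip_series (gt_group_like (g_GT 0)).1.
(* At chi = 0 the action formula has right-hand side Phi(0, 0) = 1, and 2 lambda = 1 leaves e^A and
   Phi^-1 e^B Phi as the arguments of f0. *)
have Phi_f : (Phi : serA K) *a seval (g 0).2 varA (aconj (Phi : serA K) varB) = aone _.
  have Phi0 : seval Phi (0 : serA K) 0 = aone _.
    by rewrite (seval0 hA) Phi1 scale1r.
  have FB := varB_fil K; have FQ := aconj_fil hA (Phi : serA K) FB.
  have half2 : 2 * 2^-1 = 1 :> K := divff (char0_natS_neq0 charK 1).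
  have act0 : (Phi : serA K) *a geval (g 0).2 (aexp ((2 * 2^-1) *: (varA : serA K)))
      (aconj (Phi : serA K) (aexp ((2 * 2^-1) *: (varB : serA K)))) =
      seval Phi (0 *: (varA : serA K)) (0 *: (varB : serA K)) := congr1 fst (g_act 0).
  have gevalE : geval (g 0).2 (aexp (varA : serA K))
      (aexp (aconj (Phi : serA K) varB)) = seval (g 0).2 varA (aconj (Phi : serA K) varB).
    exact (congr2 (seval (g 0).2) (alogK charK hA (varA_fil K)) (alogK charK hA FQ)).
  move: act0; rewrite half2 !scale1r !scale0r Phi0.
  (* Conjugation commutes with exp, so Phi^-1 e^B Phi has logarithm Phi^-1 B Phi. *)
  by rewrite (hom_aexp hA hA (aconj_hom charK hA Phi_unip) FB) gevalE.
split=> [B|C]; first exact: tw_zero_tw_assoc.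
exact: tw_assoc_tw_zero.
Qed.
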